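(* Let $\alpha,\beta,\mu,\eta$ be constants as in the context. There is a constant $C_1$ such that for every $n$, the number of $\mathcal{H}\in Forb(n,T_5,\eta,\mu)$ that violate at least one of the conditions (1)–(5) below is at most $C_1\cdot 2^{-n/10}S(n)$: (1) In every optimal partition $(X,Y)$ of $\mathcal{H}$ and for every $x\in X$ we have $|L_{Y,Y}(x)|<\beta n^2$. (2) In every optimal partition $(X,Y)$ of $\mathcal{H}$, every $y\in Y$ satisfies $|L_{Y,Y}(y)|<2\mu n^2$. (3) No optimal partition $(X,Y)$ of $\mathcal{H}$ has an $\alpha$-rich edge. (4) No optimal partition $(X,Y)$ of $\mathcal{H}$ has an inconsistent edge $xyz$ with $|\{x,y,z\}\cap X|\in\{0,3\}$. (5) No optimal partition $(X,Y)$ of $\mathcal{H}$ has an inconsistent edge $xyz$ with $|\{x,y,z\}\cap X|=1$.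
   Context: A 3-graph on $[n]$ is a set of 3-subsets of $[n]$; $T_5=\{123,124,125,345\}$. $H(x)=-x\log_2x-(1-x)\log_2(1-x)$ is the binary entropy function. The constants satisfy $1\gg\alpha\gg\beta\gg\mu\gg\eta>0$ (each sufficiently small relative to the preceding ones), and in particular $0.01>H(\alpha)$, $\alpha^2>100(H(\beta)+H(2\mu)+\mu^2)$, $\beta>100H(2\mu)$, $\mu^3\ge 1000H(\eta)$. For an ordered partition $(X,Y)$ of the vertex set, an edge is consistent if it has exactly two vertices in $X$, inconsistent otherwise; a partition is optimal if it minimizes the number of inconsistent edges, and $D_{\mathcal{H}}$ is that minimum. $Forb(n,T_5,\eta)$ is the set of $T_5$-free 3-graphs on $[n]$ with $D_{\mathcal{H}}\le\eta n^3$. A semi-bipartite 3-graph is one with an ordered partition having no inconsistent edges; $S(n)$ is the number of semi-bipartite 3-graphs on $[n]$. An ordered partition $(X,Y)$ of $\mathcal{H}$ is $\mu$-lower-dense if: (i) for every matching $G_1\subset\binom{X}{2}$ and every graph $G_2\subset X\times Y$ with $|G_1|>\mu n$, $|G_2|>\mu n^2$, the number of pairs $(ab,uv)$ with $ab\in G_2$, $uv\in G_1$, $abu,abv\in\mathcal{H}$ exceeds $|G_1||G_2|/72$; (ii) for every graph $G_1\subset\binom{X}{2}$ and every matching $G_2\subset\binom{Y}{2}$ with $|G_1|>\mu n^2$, $|G_2|>\mu n$, the number of pairs $(ab,uv)$ with $ab\in G_2$, $uv\in G_1$, $auv,buv\in\mathcal{H}$ exceeds $|G_1||G_2|/8$;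 (iii) for every $A_X\subset X$, $A_Y\subset Y$ with $|A_X|,|A_Y|\ge\mu n$, the number of edges $E$ with $|E\cap A_X|=2$, $|E\cap A_Y|=1$ exceeds $|A_X|^2|A_Y|/8$; (iv) for every $Y'\subset Y$ with $|Y'|\ge 2\mu n$ and sets $X_y\subset X$ ($y\in Y'$) with $|X_y|>200\mu n$, the number of edges $E$ for which some $y\in Y'$ has $y\in E$ and $|E\cap X_y|=2$ exceeds $10000\mu^3n^3$; (v) $||Y|-n/3|<\mu n$. $Forb(n,T_5,\eta,\mu)$ is the set of $\mathcal{H}\in Forb(n,T_5,\eta)$ all of whose optimal partitions are $\mu$-lower-dense. For a vertex $v$ and sets $A,B\in\{X,Y\}$, $L_{A,B}(v)$ is the set of edges of $\mathcal{H}$ containing $v$ whose other two vertices lie one in $A$ and one in $B$ (both in $A$ if $A=B$), viewed as the graph of these other pairs. For a 2-set $S$ and $A\subset[n]$, $L_A(S)=\{v\in A: S\cup\{v\}\in\mathcal{H}\}$. An edge $xyz$ is $\alpha$-rich with respect to $(X,Y)$ if $x\in X$, $y,z\in Y$ and $\max\{|L_X(\{x,y\})|,|L_X(\{x,z\})|\}>\alpha n$. *)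

(* Defs.v *)
From HB Require Import structures.
From mathcomp Require Import all_boot all_order all_algebra.
From mathcomp Require Import boolp reals exp.

Set Implicit Arguments.
Unset Strict Implicit.
Unset Printing Implicit Defensive.

Import Order.TTheory GRing.Theory Num.Theory.
Local Open Scope ring_scope.

Definition log2 {R : realType} (x : R) : R := ln x / ln 2.

Definition entropy {R : realType} (x : R) : R :=
  - x * log2 x - (1 - x) * log2 (1 - x).

(* A 3-graph on [n] is a set of subsets of 'I_n satisfying [three_graph]. *)
Notation hypergraph n := {set {set 'I_n}}.

Definition three_graph n (H : hypergraph n) : Prop :=
  forall e, e \in H -> #|e| = 3%N.

(* [T5] has its vertices 1, ..., 5 renamed 0, ..., 4. *)
Definition T5 : hypergraph 5 :=
  let v i : 'I_5 := inord i in
  [set [set v 0%N; v 1%N; v 2%N]; [set v 0%N; v 1%N; v 3%N];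
       [set v 0%N; v 1%N; v 4%N]; [set v 2%N; v 3%N; v 4%N]].

(* Not necessarily induced copies. *)
Definition contains n m (H : hypergraph n) (F : hypergraph m) : Prop :=
  exists2 f : 'I_m -> 'I_n, injective f & forall e, e \in F -> f @: e \in H.

(* An ordered partition (X, Y) of the vertex set is represented by its first
   part X, with Y = ~: X; empty parts are allowed. *)
Definition inconsistent n (H : hypergraph n) (X : {set 'I_n}) : hypergraph n :=
  [set e in H | #|e :&: X| != 2%N].

Definition optimal n (H : hypergraph n) (X : {set 'I_n}) : Prop :=
  forall X' : {set 'I_n}, (#|inconsistent H X| <= #|inconsistent H X'|)%N.

Definition min_inconsistent n (H : hypergraph n) : nat :=
  #|inconsistent H [arg min_(X < set0) #|inconsistent H X| ]|.

Definition semi_bipartite n (H : hypergraph n) : Prop :=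
  three_graph H /\ exists X, inconsistent H X = set0.

Definition num_semi_bipartite (n : nat) : nat :=
  #|[set H : hypergraph n | `[< semi_bipartite H >]]|.

Definition Forb_near {R : realType} n (eta : R) (H : hypergraph n) : Prop :=
  [/\ three_graph H, ~ contains H T5
    & (min_inconsistent H)%:R <= eta * n%:R ^+ 3].

Definition pairs_in n (A : {set 'I_n}) : {set {set 'I_n}} :=
  [set p : {set 'I_n} | (p \subset A) && (#|p| == 2%N)].

(* Matchings are the graphs G with [trivIset G]. *)
Definition lower_dense {R : realType} n (mu : R) (H : hypergraph n)
    (X : {set 'I_n}) : Prop :=
  let Y := ~: X in
  [/\ forall (G1 : {set {set 'I_n}}) (G2 : {set 'I_n * 'I_n}),
        G1 \subset pairs_in X -> trivIset G1 -> G2 \subset setX X Y ->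
        mu * n%:R < #|G1|%:R -> mu * n%:R ^+ 2 < #|G2|%:R ->
        #|G1|%:R * #|G2|%:R / 72 <
        #|[set p : ('I_n * 'I_n) * {set 'I_n} |
            [&& p.1 \in G2, p.2 \in G1
              & [forall u in p.2, [set p.1.1; p.1.2; u] \in H]]]|%:R :> R,
      forall G1 G2 : {set {set 'I_n}},
        G1 \subset pairs_in X -> G2 \subset pairs_in Y -> trivIset G2 ->
        mu * n%:R ^+ 2 < #|G1|%:R -> mu * n%:R < #|G2|%:R ->
        #|G1|%:R * #|G2|%:R / 8 <
        #|[set p : {set 'I_n} * {set 'I_n} |
            [&& p.1 \in G2, p.2 \in G1
              & [forall a in p.1, a |: p.2 \in H]]]|%:R :> R,
      forall AX AY : {set 'I_n},
        AX \subset X -> AY \subset Y ->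
        mu * n%:R <= #|AX|%:R -> mu * n%:R <= #|AY|%:R ->
        #|AX|%:R ^+ 2 * #|AY|%:R / 8 <
        #|[set e in H | (#|e :&: AX| == 2%N) && (#|e :&: AY| == 1%N)]|%:R :> R,
      forall (Y' : {set 'I_n}) (F : 'I_n -> {set 'I_n}),
        Y' \subset Y -> 2 * mu * n%:R <= #|Y'|%:R ->
        (forall y, y \in Y' ->
          F y \subset X /\ 200 * mu * n%:R < #|F y|%:R) ->
        10000 * mu ^+ 3 * n%:R ^+ 3 <
        #|[set e in H | [exists y in Y', (y \in e) && (#|e :&: F y| == 2%N)]]|%:R
    & `| #|Y|%:R - n%:R / 3 | < mu * n%:R].

Definition Forb_dense {R : realType} n (eta mu : R) (H : hypergraph n) : Prop :=
  Forb_near eta H /\ forall X, optimal H X -> lower_dense mu H X.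

(* For a 3-graph H, [set v; a; b] \in H forces v, a and b to be distinct. *)
Definition link_graph n (H : hypergraph n) (A B : {set 'I_n}) (v : 'I_n) :
    {set {set 'I_n}} :=
  [set [set a; b] | a in A, b in B & [set v; a; b] \in H].

Definition link_set n (H : hypergraph n) (A S : {set 'I_n}) : {set 'I_n} :=
  [set v in A | v |: S \in H].

Definition rich {R : realType} n (alpha : R) (H : hypergraph n)
    (X e : {set 'I_n}) : Prop :=
  e \in H /\
  exists x y z,
    [/\ e = [set x; y; z], x \in X, y \in ~: X, z \in ~: X
      & alpha * n%:R <
        (maxn #|link_set H X [set x; y]| #|link_set H X [set x; z]|)%:R].

Definition cond1 {R : realType} n (beta : R) (H : hypergraph n) : Prop :=
  forall X, optimal H X -> forall x, x \in X ->
    #|link_graph H (~: X) (~: X) x|%:R < beta * n%:R ^+ 2.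

Definition cond2 {R : realType} n (mu : R) (H : hypergraph n) : Prop :=
  forall X, optimal H X -> forall y, y \in ~: X ->
    #|link_graph H (~: X) (~: X) y|%:R < 2 * mu * n%:R ^+ 2.

Definition cond3 {R : realType} n (alpha : R) (H : hypergraph n) : Prop :=
  forall X, optimal H X -> ~ exists e, rich alpha H X e.

Definition cond4 n (H : hypergraph n) : Prop :=
  forall X, optimal H X ->
    ~ exists2 e, e \in inconsistent H X & #|e :&: X| = 0%N \/ #|e :&: X| = 3%N.

Definition cond5 n (H : hypergraph n) : Prop :=
  forall X, optimal H X ->
    ~ exists2 e, e \in inconsistent H X & #|e :&: X| = 1%N.

Definition bad {R : realType} n (alpha beta mu eta : R) : {set hypergraph n} :=
  [set H : hypergraph n |
    `[< Forb_dense eta mu H /\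
        ~ [/\ cond1 beta H, cond2 mu H, cond3 alpha H, cond4 H & cond5 H] >]].

(* Main.v *)
Require Import Defs.
From HB Require Import structures.
From mathcomp Require Import all_boot all_order all_algebra.
From mathcomp Require Import boolp reals exp.
From mathcomp Require Import sequences ring lra.

(* Fix an optimal partition (X, Y) and let slots X V be the triples inside V
   with exactly two points in X; S(n) is at least 2 ^ #|slots X setT| for each
   X, so it suffices to beat this by a factor 2 ^ (- 6n/5) and sum over the 2^n
   choices of X.  Every violation of (1)-(5) produces an inconsistent edge, so
   we count the H having one.

   Let G be the trace of H on V, where V misses at most mu n vertices.  Lower
   density, T5-freeness and optimality leave two possibilities.  Either some set
   T of one or three vertices is such that the edges of G meeting T lie in a
   family of size at most 2 ^ (#|slots meeting T| - beta n^2 / 4): T is a vertex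
   of Y with many YY-edges, or a vertex z of Y whose link has a large
   independent set in X, or a vertex of X with many YY-edges, or an edge inside
   X or inside Y.  Or all inconsistent edges of G are of type XYY and each pair
   xy in them has small codegree in X; a double count over these thin pairs
   gains 2 ^ (6n/5) as soon as there is one.

   Deleting such sets T one after the other gains more than the crude bound
   2 ^ (o(n^3)) on the number of sets of at most eta n^3 inconsistent edges
   costs, once about mu n / 3 of them have been deleted.  This recursion on
   traces replaces an induction on n. *)

Set Implicit Arguments.
Unset Strict Implicit.
Unset Printing Implicit Defensive.

Import Order.TTheory GRing.Theory Num.Theory.
Local Open Scope ring_scope.

(** * Powers of two and counting families of sets *)

(** The tightest case is a single XYY-edge xyz. It makes only the two pairs xy and xz thin, and
    these lie in about 2 (2n/3) = 4n/3 slots. The gain has to exceed n, because the sum over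
    partitions costs 2^n; this is why 6n/5 is the target and why X must keep 0.66 n vertices. The
    deletable sets T gain order n^2 each, yet one deletion is not enough: for the traces on the
    smaller set only the crude bound is known, which loses 2^(eps n^3). Half of the gain beta n^2 /
    4 pays for the choice of T, so about mu n / 3 deletions save roughly beta mu n^3 / 24. As eta is
    chosen after beta and mu, eps can be taken to be beta mu / 32. Induction on n is obstructed
    because deleting T from H may destroy the optimality of the partition and the lower density. A
    trace still comes from some H on all n vertices, for which both hold with unchanged parameters;
    restricting to V removes at most mu n^2 edges at a vertex. *)

Section Exp2.
Variable R : realType.
Implicit Types x y : R.

Lemma exp2_gt0 x : 0 < 2 `^ x. Proof. by rewrite powR_gt0. Qed.

Lemma exp2_ge0 x : 0 <= 2 `^ x. Proof. exact: powR_ge0. Qed.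

Lemma exp2D x y : 2 `^ (x + y) = 2 `^ x * 2 `^ y :> R.
Proof. by rewrite powRD // pnatr_eq0 /= implybT. Qed.

Lemma ler_exp2 x y : x <= y -> 2 `^ x <= 2 `^ y :> R.
Proof. by move=> xy; rewrite ler_powR // ler1n. Qed.

Lemma exp2_nat (m : nat) : (2 ^ m)%:R = 2 `^ m%:R :> R.
Proof. by rewrite natrX powR_mulrn. Qed.

Lemma exp2X x (m : nat) : (2 `^ x) ^+ m = 2 `^ (x * m%:R) :> R.
Proof. by rewrite powRrM powR_mulrn // exp2_ge0. Qed.

Lemma exp2_log2 x : 0 < x -> 2 `^ (ln x / ln 2) = x.
Proof.
move=> x0; rewrite /powR pnatr_eq0 /= divfK ?lnK ?posrE //.
by rewrite gt_eqF // ln_gt0 // ltr1n.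
Qed.

Lemma exp2_card_powerset (T : finType) (A : {set T}) :
  #|powerset A|%:R = 2 `^ #|A|%:R :> R.
Proof. by rewrite card_powerset exp2_nat. Qed.

End Exp2.

Section Counting.
Variable T : finType.
Implicit Types (F : {set {set T}}) (U K : {set T}).

(** The map [L |-> (L :&: U, L :\: U)] is injective. Most counts below use it to peel off one type
    of edge at a time. *)
Lemma card_split F F1 F2 U :
  (forall L, L \in F -> L :&: U \in F1) ->
  (forall L, L \in F -> L :\: U \in F2) ->
  (#|F| <= #|F1| * #|F2|)%N.
Proof.
move=> h1 h2; rewrite -cardsX.
rewrite -(card_in_imset (f := fun L => (L :&: U, L :\: U)) (D := mem F)).
  by apply/subset_leq_card/subsetP => _ /imsetP[L LF ->]; rewrite inE /= h1 ?h2.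
by move=> L L' _ _ [e1 e2]; rewrite -(setID L U) e1 e2 setID.
Qed.

(** The blocks [U i] may overlap: as they cover [L], its intersections with them determine it.
    Below, a block consists of the triples through a given vertex or pair, and such blocks can share
    triples. *)
Lemma card_cover_le (I : finType) (J : {set I}) F (U : I -> {set T})
    (F' : I -> {set {set T}}) :
  (forall L, L \in F -> L \subset \bigcup_(i in J) U i) ->
  (forall L i, L \in F -> i \in J -> L :&: U i \in F' i) ->
  (#|F| <= \prod_(i in J) #|F' i|)%N.
Proof.
move=> cov h.
pose f L := [ffun i => if i \in J then L :&: U i else set0].
pose B i := if i \in J then F' i else [set set0].
rewrite -(card_in_imset (f := f) (D := mem F)); last first.
  move=> L L' LF LF' /ffunP e; apply/setP => x.
  suff sub A A' : A \in F -> f A =1 f A' -> x \in A -> x \in A'.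
    by apply/idP/idP; apply: sub => // i; rewrite e.
  move=> AF eA xA; have /bigcupP[i iJ xU] := subsetP (cov _ AF) _ xA.
  by move: (eA i); rewrite !ffunE iJ => /setP/(_ x); rewrite !inE xA xU !andbT => <-.
have -> : (\prod_(i in J) #|F' i| = #|family (fun i => mem (B i))|)%N.
  rewrite card_family foldrE big_map big_enum /= big_mkcond.
  by apply: eq_bigr => i _; rewrite /B; case: ifP => // _; rewrite cards1.
apply/subset_leq_card/subsetP => _ /imsetP[L LF ->].
apply/familyP => i; rewrite ffunE /B; case: ifP => iJ; first exact: h.
by rewrite inE.
Qed.

Lemma card_bigcup_sum (I : finType) (P : pred I) (S : I -> {set T}) :
  (#|\bigcup_(i | P i) S i| <= \sum_(i | P i) #|S i|)%N.
Proof.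
elim/big_rec2: _ => [|i x A iP le]; first by rewrite cards0.
by apply: leq_trans (leq_card_setU _ _) _; rewrite leq_add2l.
Qed.

Lemma card_bigcup_le (R : numDomainType) (I : finType) (P : {set I})
    (S : I -> {set T}) (b : R) :
  (forall i, i \in P -> #|S i|%:R <= b) ->
  #|\bigcup_(i in P) S i|%:R <= #|P|%:R * b.
Proof.
move=> h; apply: (@le_trans _ _ (\sum_(i in P) #|S i|%:R)).
  by rewrite -natr_sum ler_nat card_bigcup_sum.
by rewrite mulr_natl -sumr_const; apply: ler_sum.
Qed.

(** Each block admits 7 of its 8 subsets and the rest of [K] is free. The second conclusion
    certifies that the subtraction in the first is not truncated. *)
Lemma card_missing_blocks (I : finType) (P : {set I}) (U : I -> {set T}) K F :
  (forall p, p \in P -> U p \subset K /\ #|U p| = 3%N) ->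
  {in P &, forall p p', p != p' -> [disjoint U p & U p']} ->
  (forall L, L \in F -> L \subset K /\ forall p, p \in P -> ~~ (U p \subset L)) ->
  (#|F| <= 7 ^ #|P| * 2 ^ (#|K| - 3 * #|P|) /\ 3 * #|P| <= #|K|)%N.
Proof.
move=> hU dis hF; pose W := \bigcup_(p in P) U p.
have WK : W \subset K by apply/bigcupsP => p /hU[].
have cW : (#|W| = 3 * #|P|)%N.
  have triv : trivIset (U @: P).
    apply/trivIsetP => _ _ /imsetP[p pP ->] /imsetP[p' pP' ->] ne.
    by apply: dis => //; apply: contra ne => /eqP->.
  have injU : {in P &, injective U}.
    move=> p p' pP pP' e; apply/eqP/negPn/negP => /(dis _ _ pP pP').
    rewrite e -setI_eq0 setIid => /eqP U0.
    by have [_] := hU _ pP'; rewrite U0 cards0.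
  have -> : W = cover (U @: P) by rewrite /cover big_imset.
  rewrite -(eqP triv) big_imset //= (eq_bigr (fun=> 3%N)).
    by rewrite sum_nat_const mulnC.
  by move=> p /hU[].
have K3 : (3 * #|P| <= #|K|)%N by rewrite -cW subset_leq_card.
split=> //.
pose F1 := [set L :&: W | L in F].
apply: leq_trans (_ : #|F1| * #|powerset (K :\: W)| <= _)%N.
  apply: (@card_split _ _ _ W) => L LF; first exact: imset_f.
  by rewrite inE setSD //; have [] := hF _ LF.
apply: leq_mul; last first.
  by rewrite card_powerset leq_exp2l // cardsD (setIidPr WK) cW.
apply: leq_trans (_ : \prod_(p in P) #|powerset (U p) :\ U p| <= _)%N.
  apply: (@card_cover_le _ P _ U).
    by move=> _ /imsetP[L LF ->]; exact: subsetIr.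
  move=> _ p /imsetP[L LF ->] pP; rewrite !inE subsetIr andbT.
  apply/eqP => e; have [_ /(_ p pP)/negP[]] := hF _ LF.
  by rewrite -e -setIA subsetIl.
rewrite (eq_bigr (fun=> 7%N)) ?prod_nat_const // => p /hU[_ c].
by rewrite cardsDS ?sub1set ?inE // cards1 card_powerset c.
Qed.

End Counting.

(** * Binomial tails by exponential weights *)

Section SmallSubsets.
Variable R : realType.

(* Plays the role of the bound [entropy delta <= eps] on binomial sums. *)
Definition few_small (eps delta : R) : Prop :=
  forall (T : finType) (U : {set T}) (N : R), #|U|%:R <= N ->
  #|[set L : {set T} | (L \subset U) && (#|L|%:R <= delta * N)]|%:R
    <= 2 `^ (eps * N).

Lemma sum_subsets_expr (T : finType) (U : {set T}) (t : R) :
  \sum_(L : {set T} | L \subset U) t ^+ #|L| = (1 + t) ^+ #|U|.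
Proof.
(* Weight 0 outside [U] kills the sets not contained in [U] once the product is expanded over the
   whole type. *)
have -> : (1 + t) ^+ #|U| = \prod_i ((if i \in U then t else 0) + 1).
  rewrite -prodr_const big_mkcond /=; apply: eq_bigr => i _.
  by case: ifP => _; rewrite ?add0r // addrC.
rewrite bigA_distr big_mkcond /=; apply: eq_bigr => L _.
rewrite -big_mkcond /=.
case: ifP => [/subsetP sLU|/negbT /subsetPn[i iL iU]]; last first.
  by rewrite (bigD1 i) //= (negbTE iU) mul0r.
by rewrite -prodr_const; apply: eq_bigr => i /sLU ->.
Qed.

(** An exponential moment bound: give [L] the weight [t ^+ #|L|]. The total weight (1 + t)^|U| is at
    most 2^(eps N / 2), while each small set weighs at least 2^(- eps N / 2). *)
Lemma few_small_exists (eps : R) : 0 < eps ->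
  exists2 delta, 0 < delta & few_small eps delta.
Proof.
move=> eps0; pose b := eps / 2.
have b0 : 0 < b by rewrite /b; lra.
have b1 : 1 < 2 `^ b :> R.
  rewrite -[X in X < _](exp2_log2 ltr01) ln1 mul0r.
  rewrite /powR pnatr_eq0 /= ltr_expR mul0r mulr_gt0 // ln_gt0 //.
  by rewrite ltr1n.
pose t := Num.min 1 (2 `^ b - 1) : R.
have t0 : 0 < t by rewrite lt_min ltr01 subr_gt0.
have t1 : t <= 1 by rewrite ge_min lexx.
have tb : 1 + t <= 2 `^ b by rewrite addrC -lerBrDr ge_min lexx orbT.
pose a : R := - (ln t / ln 2).
have a0 : 0 <= a.
  rewrite /a oppr_ge0 pmulr_lle0 ?invr_gt0 ?ln_gt0 ?ltr1n //.
  by rewrite -ln1 ler_ln ?posrE.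
have tE : t = 2 `^ (- a) by rewrite opprK exp2_log2.
have a1 : 0 < a + 1 by lra.
(* The denominator is [a + 1] because [a] vanishes when [t = 1]. *)
exists (b / (a + 1)) => [|T U N UN]; first exact: divr_gt0.
have N0 : 0 <= N by apply: le_trans UN.
set m := b / (a + 1) * N.
have am : a * m <= b * N.
  rewrite /m mulrA ler_wpM2r // mulrCA ger_pMr // ler_pdivrMr //; lra.
set F := [set L | _].
have lb : #|F|%:R * 2 `^ (- (a * m)) <= (1 + t) ^+ #|U|.
  rewrite -sum_subsets_expr mulr_natl -sumr_const.
  rewrite big_mkcond [leRHS]big_mkcond /=; apply: ler_sum => L _.
  rewrite inE; case: (L \subset U) => //=; case: ifP => // Lm.
    by rewrite tE exp2X; apply: ler_exp2; rewrite (mulNr a) lerN2 ler_wpM2l.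
  by rewrite exprn_ge0 // ltW.
have ub : (1 + t) ^+ #|U| <= 2 `^ (b * N).
  apply: le_trans (_ : (2 `^ b) ^+ #|U| <= _).
    by rewrite lerXn2r ?nnegrE ?exp2_ge0 //; lra.
  by rewrite exp2X ler_exp2 // ler_wpM2l // ltW.
have := le_trans lb ub.
rewrite -(ler_pM2r (exp2_gt0 (a * m))) -mulrA -!exp2D addNr powRr0 mulr1.
move=> h; apply: le_trans h _; apply: ler_exp2.
have -> : eps = b + b by rewrite /b; field.
by rewrite mulrDl lerD2l.
Qed.

Lemma few_smallW (eps delta delta' : R) :
  delta' <= delta -> few_small eps delta -> few_small eps delta'.
Proof.
move=> dd h T U N UN; apply: le_trans (h T U N UN); rewrite ler_nat.
apply/subset_leq_card/subsetP => L; rewrite !inE => /andP[-> /=] le.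
by apply: le_trans le _; rewrite ler_wpM2r // (le_trans _ UN).
Qed.

End SmallSubsets.

(** * Statements for large n and the binary logarithm *)

Section Asymptotics.
Variable R : realType.

Definition lg (n : nat) : R := ln n%:R / ln 2.

Lemma exp2_lg n : (0 < n)%N -> 2 `^ lg n = n%:R :> R.
Proof. by move=> n0; rewrite exp2_log2 // ltr0n. Qed.

Definition eventually (P : nat -> Prop) : Prop :=
  exists n0, forall n, (n0 <= n)%N -> P n.

Lemma eventuallyI (P Q : nat -> Prop) :
  eventually P -> eventually Q -> eventually (fun n => P n /\ Q n).
Proof.
move=> [a ha] [b hb]; exists (maxn a b) => n; rewrite geq_max => /andP[an bn].
by split; [exact: ha|exact: hb].
Qed.

Lemma eventually_ge (c : R) : eventually (fun n => c <= n%:R).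
Proof.
exists (Num.bound `|c|) => n le; apply: le_trans (ler_norm c) _; apply: ltW.
by apply: lt_le_trans (archi_boundP (normr_ge0 c)) _; rewrite ler_nat.
Qed.

Lemma eventually_lg_le (c : R) : 0 < c ->
  eventually (fun n => lg n <= c * n%:R).
Proof.
move=> c0; have l2 : 0 < ln 2 :> R by rewrite ln_gt0 // ltr1n.
(* One half of the slope bounds [ln (d * n%:R)] through ln y <= y - 1, the other half absorbs
   [- ln d]. *)
pose d := c * ln 2 / 2; have d0 : 0 < d by rewrite /d divr_gt0 // mulr_gt0.
have [n0 h0] := eventually_ge (- (ln d) / d).
exists (maxn n0 1) => n; rewrite geq_max => /andP[/h0 h n1].
have np : 0 < n%:R :> R by rewrite ltr0n.
rewrite /lg ler_pdivrMr //.
have -> : c * n%:R * ln 2 = d * n%:R + d * n%:R by rewrite /d; field.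
have dn0 : 0 < d * n%:R by rewrite mulr_gt0.
have h1 : ln (d * n%:R) <= d * n%:R - 1.
  rewrite -[in leLHS](subrKC 1 (d * n%:R)); apply: le_ln1Dx; lra.
have h2 : - ln d <= d * n%:R by rewrite mulrC -ler_pdivrMr.
move: h1; rewrite lnM ?posrE //; lra.
Qed.

End Asymptotics.

(** * Triples *)

Section Triples.
Variable n : nat.
Implicit Types (V T X A B e p : {set 'I_n}) (G L : {set {set 'I_n}}).
Implicit Types (u v w x y z a b : 'I_n).

Definition triples V : {set {set 'I_n}} :=
  [set e : {set 'I_n} | (e \subset V) && (#|e| == 3%N)].

Definition restr V G : {set {set 'I_n}} := [set e in G | e \subset V].

Definition touch T G : {set {set 'I_n}} :=
  [set e in G | ~~ [disjoint e & T]].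

Definition slots X V : {set {set 'I_n}} :=
  [set e in triples V | #|e :&: X| == 2%N].

Lemma bin2R (R : numFieldType) (m : nat) :
  'C(m, 2)%:R = m%:R * (m%:R - 1) / 2 :> R.
Proof.
case: m => [|m]; first by rewrite bin0n !mul0r.
have e : ('C(m.+1, 2) * 2 = m.+1 * m)%N.
  by rewrite bin2 /= muln2 -[RHS]odd_double_half oddM /= andNb.
have -> : m.+1%:R - 1 = m%:R :> R by rewrite -natr1 addrK.
by rewrite -natrM -e natrM mulfK // pnatr_eq0.
Qed.

Lemma card_pairs_in A : #|pairs_in A| = 'C(#|A|, 2).
Proof. exact: cards_draws. Qed.

Lemma touch1E v G e : (e \in touch [set v] G) = (e \in G) && (v \in e).
Proof. by rewrite inE disjoint_sym disjoints1 negbK. Qed.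

Lemma setU1_inj v A B :
  v \notin A -> v \notin B -> v |: A = v |: B -> A = B.
Proof. by move=> vA vB e; rewrite -(setU1K vA) e setU1K. Qed.

Lemma card_setU1_pairs v A :
  v \notin A -> #|[set v |: p | p in pairs_in A]| = 'C(#|A|, 2).
Proof.
move=> vA; rewrite card_in_imset ?card_pairs_in // => p p'.
rewrite !inE => /andP[/subsetP pA _] /andP[/subsetP p'A _].
by apply: setU1_inj; apply: contra vA; auto.
Qed.

Lemma triple_at V v e : e \in triples V -> v \in e ->
  exists a b, [/\ a != b, e = [set v; a; b] & e :\ v = [set a; b]] /\
              [/\ v != a, v != b, a \in V & b \in V].
Proof.
rewrite inE => /andP[/subsetP eV /eqP e3] ve.
have /cards2P[a [b [ab E]]] : #|e :\ v| == 2%N.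
  by move: e3; rewrite (cardsD1 v) ve add1n => -[->].
have va : a \in e :\ v by rewrite E !inE eqxx.
have vb : b \in e :\ v by rewrite E !inE eqxx orbT.
move: va vb; rewrite !inE => /andP[av ae] /andP[bv be].
exists a, b; split; last by split; rewrite 1?eq_sym ?eV.
by split=> //; rewrite -setUA -E setD1K.
Qed.

Lemma card_touch1_le V v : (#|touch [set v] (triples V)| <= n ^ 2)%N.
Proof.
have -> : (n ^ 2 = #|[set: 'I_n * 'I_n]|)%N.
  by rewrite cardsT card_prod card_ord mulnn.
apply: leq_trans (leq_imset_card (fun q : 'I_n * 'I_n => [set v; q.1; q.2]) _).
apply/subset_leq_card/subsetP => e; rewrite touch1E => /andP[eV ve].
have [a [b [[_ -> _] _]]] := triple_at eV ve.
by apply/imsetP; exists (a, b); rewrite ?inE.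
Qed.

Lemma card_touch_le V T :
  (#|touch T (triples V)| <= #|T| * n ^ 2)%N.
Proof.
rewrite -(@ler_nat int) natrM.
apply: le_trans (card_bigcup_le (S := fun v => touch [set v] (triples V)) _);
  last by move=> v _; rewrite ler_nat card_touch1_le.
rewrite ler_nat; apply/subset_leq_card/subsetP => e; rewrite inE => /andP[eV].
rewrite -setI_eq0 => /set0Pn[v]; rewrite inE => /andP[ve vT].
by apply/bigcupP; exists v => //; rewrite touch1E eV.
Qed.

Lemma touch_restr V T G : G \subset triples V -> T \subset V ->
  G = touch T G :|: restr (V :\: T) G.
Proof.
move=> /subsetP GV TV; apply/setP => e; rewrite !inE.
have [eG|//] := boolP (e \in G); rewrite /= subsetD.
by have := GV _ eG; rewrite !inE => /andP[-> _] /=; rewrite orNb.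
Qed.

(** Slot counts add up under deletion, so the savings of successive deletions accumulate in the
    exponent. *)
Lemma card_slots_split X V T : T \subset V ->
  #|slots X V| = (#|touch T (slots X V)| + #|slots X (V :\: T)|)%N.
Proof.
move=> TV; rewrite -(cardsID (touch T (slots X V)) (slots X V)).
congr (_ + _)%N; apply: eq_card => e; rewrite !inE.
  by rewrite andbA andbb.
case: (#|e| == 3%N); last by rewrite !andbF.
rewrite subsetD; case: (e \subset V) => //=; rewrite ?andbF //.
by case: (_ == 2%N) => /=; rewrite ?andbT ?andbF // negbK.
Qed.

Lemma triple3 V v a b : v != a -> v != b -> a != b ->
  v \in V -> a \in V -> b \in V -> [set v; a; b] \in triples V.
Proof.
move=> va vb ab vV aV bV; rewrite inE; apply/andP; split.
  by apply/subsetP => w; rewrite !inE => /orP[/orP[]|] /eqP->.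
by rewrite -setUA cardsU1 cardsU1 cards1 !inE (negbTE va) (negbTE vb) (negbTE ab).
Qed.

End Triples.

Section Meet.
Variables (n : nat) (X : {set 'I_n}).
Implicit Types x a b : 'I_n.

Lemma set3_meet2 x a b : x \in X -> a \in X -> b \notin X -> a != x ->
  #|[set x; a; b] :&: X| = 2%N.
Proof.
move=> xX aX bX ax; rewrite setIUl (disjoint_setI0 (_ : [disjoint [set b] & X])).
  rewrite setU0 (setIidPl _) ?cards2 1?eq_sym ?ax //.
  by apply/subsetP => u; rewrite !inE => /orP[] /eqP->.
by rewrite disjoints1.
Qed.

Lemma set3_meet1 x a b : x \in X -> a \notin X -> b \notin X ->
  [set x; a; b] :&: X = [set x].
Proof.
move=> xX aX bX; rewrite -setUA setIUl (setIidPl _) ?sub1set //.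
rewrite (disjoint_setI0 (_ : [disjoint [set a; b] & X])) ?setU0 //.
by rewrite disjoints_subset subUset !sub1set !inE aX bX.
Qed.

End Meet.

Section LinkSizes.
Variables (n : nat) (X V : {set 'I_n}).
Implicit Types (v x y z : 'I_n) (A M e : {set 'I_n}).

Lemma card_touch_sub_le v M :
  (#|[set e in touch [set v] (triples V) | e :\ v \subset M]| <= 'C(#|M|, 2))%N.
Proof.
rewrite -card_pairs_in; apply: leq_trans (leq_imset_card (setU [set v]) _).
apply/subset_leq_card/subsetP => e; rewrite inE touch1E => /andP[/andP[eV ve] sub].
apply/imsetP; exists (e :\ v); last by rewrite setD1K.
rewrite inE sub /=; move: eV; rewrite inE => /andP[_].
by rewrite (cardsD1 v) ve.
Qed.

Lemma card_touch_slots_ge z A : z \in V :\: X -> A \subset X :&: V ->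
  ('C(#|A|, 2) <= #|[set e in touch [set z] (slots X V) | e :\ z \subset A]|)%N.
Proof.
rewrite inE => /andP[zX zV] /subsetP AXV.
have zA : z \notin A by apply: contra zX => /AXV; rewrite inE => /andP[].
rewrite -(card_setU1_pairs zA); apply/subset_leq_card/subsetP => _ /imsetP[p + ->].
rewrite inE => /andP[pA p2].
have zp : z \notin p by apply: contra zA; apply/subsetP.
have pXV : p \subset X :&: V by apply: subset_trans pA _; apply/subsetP.
move: pXV; rewrite subsetI => /andP[pX pV].
rewrite inE touch1E !inE eqxx setU1K // pA !andbT cardsU1 zp (eqP p2) eqxx andbT.
rewrite subUset sub1set zV pV /= setIUl (setIidPl pX).
by rewrite (disjoint_setI0 (_ : [disjoint [set z] & X])) ?set0U ?disjoints1.
Qed.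

(** A vertex a of X other than x and a vertex b of [M] give the slot xab; membership in X tells a
    from b, so no slot arises twice. *)
Lemma card_touch_slots_meet_ge x M : x \in X :&: V -> M \subset V :\: X ->
  ((#|X :&: V|.-1) * #|M| <=
    #|[set e in touch [set x] (slots X V) | ~~ [disjoint e & M]]|)%N.
Proof.
move=> xXV /subsetP MY.
have notX u : u \in M -> u \notin X by move/MY; rewrite inE => /andP[].
have [xX xV] : x \in X /\ x \in V by move: xXV; rewrite inE => /andP.
have -> : (#|X :&: V|.-1 = #|(X :&: V) :\ x|)%N by rewrite (cardsD1 x (X :&: V)) xXV.
rewrite -cardsX.
rewrite -(card_in_imset (f := fun r : 'I_n * 'I_n => [set x; r.1; r.2])
   (D := mem (setX ((X :&: V) :\ x) M))); last first.
  move=> [a b] [a' b']; rewrite !inE /=.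
  move=> /andP[/and3P[ax aX aV] bM] /andP[/and3P[a'x a'X a'V] b'M] E.
  have bX := notX _ bM; have b'X := notX _ b'M.
  have: a \in [set x; a'; b'] by rewrite -E !inE eqxx orbT.
  have: b \in [set x; a'; b'] by rewrite -E !inE eqxx orbT.
  rewrite !inE (negbTE ax) /= => hb ha; congr pair.
    by case/orP: ha => /eqP // e; rewrite e (negbTE b'X) in aX.
  by case/orP: hb => [/orP[]|] /eqP // e; rewrite e ?xX ?a'X in bX.
apply/subset_leq_card/subsetP => _ /imsetP[[a b] ab ->] /=.
have /and3P[ax aX aV] : [&& a != x, a \in X & a \in V].
  by move: ab; rewrite in_setX !inE => /andP[].
have bM : b \in M by move: ab; rewrite in_setX => /andP[].
have bX := notX _ bM; have := MY _ bM; rewrite inE => /andP[_ bV].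
rewrite inE touch1E inE triple3 //=.
- rewrite (set3_meet2 xX aX bX) //= !inE eqxx /=.
  by apply/pred0Pn; exists b; rewrite /= !inE eqxx bM orbT.
- by rewrite eq_sym.
- by apply: contraNneq bX => <-.
- by apply: contraNneq bX => <-.
Qed.

Lemma card_touch2_le v w : v != w ->
  (#|[set e in touch [set v] (triples V) | w \in e]| <= n)%N.
Proof.
move=> vw; rewrite -[leqRHS]card_ord -cardsT.
apply: leq_trans (leq_imset_card (fun u => [set v; w; u]) _).
apply/subset_leq_card/subsetP => e; rewrite inE touch1E => /andP[/andP[eV ve] we].
have {we}: w \in e :\ v by rewrite !inE eq_sym vw.
have [a [b [[ab -> ->] _]]] := triple_at eV ve.
rewrite !inE => /orP[] /eqP->; apply/imsetP.
  by exists b; rewrite ?inE.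
by exists a; rewrite ?inE // setUAC.
Qed.

End LinkSizes.

(** * Families of links that save a factor 2 ^ (beta n^2 / 4) *)

Lemma powerset_exp (R : realType) (T : finType) (U : {set T}) (a : R) :
  #|U|%:R <= a -> #|powerset U|%:R <= 2 `^ a.
Proof. by move=> le; rewrite exp2_card_powerset ler_exp2. Qed.

Section ExpBounds.
Variables (R : realType) (T : finType).
Implicit Types (F : {set {set T}}) (U K B : {set T}) (a b : R).

Lemma card_split_exp F F1 F2 U a b :
  (forall L, L \in F -> L :&: U \in F1) ->
  (forall L, L \in F -> L :\: U \in F2) ->
  #|F1|%:R <= 2 `^ a -> #|F2|%:R <= 2 `^ b -> #|F|%:R <= 2 `^ (a + b).
Proof.
move=> h1 h2 le1 le2; rewrite exp2D.
apply: le_trans (ler_pM (ler0n _ _) (ler0n _ _) le1 le2).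
by rewrite -natrM ler_nat; apply: card_split h1 h2.
Qed.

(** The price of guessing an auxiliary subset of [W] is [w] in the exponent. *)
Lemma card_bigcup_powerset_exp (I : finType) (W : {set I}) (S : {set I} -> {set {set T}})
    (b w : R) : #|W|%:R <= w ->
  (forall A : {set I}, A \subset W -> #|S A|%:R <= 2 `^ b) ->
  #|\bigcup_(A : {set I} | A \in powerset W) S A|%:R <= 2 `^ (w + b).
Proof.
move=> Ww h; rewrite exp2D.
apply: le_trans (card_bigcup_le (b := 2 `^ b) _) _.
  by move=> A; rewrite inE; exact: h.
apply: ler_wpM2r; [exact: exp2_ge0|exact: powerset_exp].
Qed.

End ExpBounds.

Section Families.
Variables (R : realType) (n : nat) (X V : {set 'I_n}) (alpha beta mu : R).
Local Notation N := (@GRing.natmul R 1 n).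
Local Notation p := (@GRing.natmul R 1 #|X :&: V|).
Local Notation q := (@GRing.natmul R 1 #|V :\: X|).
Local Notation K T := (@GRing.natmul R 1 #|touch T (slots X V)|).
Implicit Types (x y z : 'I_n) (A M e : {set 'I_n}) (L : {set {set 'I_n}}).

(* Members of these families are meant to be the sets of edges meeting T.  An
   edge e at x in X is of type XYY iff #|e :&: X| = 1, and an edge e at y in Y is
   of type YYY iff e :&: X = set0. *)
Definition heavyY y : {set {set {set 'I_n}}} :=
  [set L : {set {set 'I_n}} | (L \subset touch [set y] (triples V)) &&
     (#|[set e in L | e :&: X != set0]|%:R <= 5 * mu * N ^+ 2)].

Definition sparseY z : {set {set {set 'I_n}}} :=
  [set L : {set {set 'I_n}} | [&& L \subset touch [set z] (triples V),
     #|[set e in L | #|e :&: X| != 2%N]|%:R <= 5 * mu * N ^+ 2 &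
     [exists A : {set 'I_n}, [&& A \subset X :&: V, alpha * N <= #|A|%:R
        & [forall e in L, ~~ (e :\ z \subset A)]]]]].

Definition heavyX x : {set {set {set 'I_n}}} :=
  [set L : {set {set 'I_n}} | [&& L \subset touch [set x] (triples V),
     #|[set e in L | #|e :&: X| == 3%N]|%:R <= 5 * mu * N ^+ 2,
     beta * N ^+ 2 <= #|[set e in L | #|e :&: X| == 1%N]|%:R &
     [forall y in V :\: X,
        [exists e in L, (#|e :&: X| == 1%N) && (y \in e)] ==>
        (#|[set e in L | (#|e :&: X| == 2%N) && (y \in e)]|%:R <= alpha * N)]]].

Definition monoEdge (T : {set 'I_n}) : {set {set {set 'I_n}}} :=
  [set L : {set {set 'I_n}} | [&& L \subset touch T (triples V),
     #|[set e in L | #|e :&: X| != 2%N]|%:R <= 18 * beta * N ^+ 2 &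
     [forall P in pairs_in (V :\: T), ~~ [forall t in T, t |: P \in L]]]].

Hypothesis few_mu : few_small (beta / 20) (5 * mu).
Hypothesis few_alpha : few_small (1 / 100) alpha.
Hypothesis few_beta : few_small (1 / 300) (6 * beta).
Hypothesis p_ge : 66 / 100 * N <= p.
Hypothesis q_ge : 33 / 100 * N <= q.
Hypothesis q_le : q <= 335 / 1000 * N.
Hypothesis alpha01 : 0 < alpha <= 1.
Hypothesis beta0 : 0 < beta.
Hypothesis beta_le : beta <= 1 / 25.
Hypothesis beta_alpha : beta <= alpha ^+ 2.
Hypothesis n_large : 100 <= beta * N.

Lemma n_ge2500 : 2500 <= N.
Proof.
have h : beta * N <= 1 / 25 * N by rewrite ler_wpM2r.
by move: n_large h => h0 h; lra.
Qed.

(** Lets a quadratic saving absorb the 2^n guesses of a vertex set. *)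
Lemma N_le_sqr : N <= beta * N ^+ 2 / 100.
Proof.
have h : 100 * N <= beta * N * N by rewrite ler_wpM2r.
by rewrite expr2 mulrA; lra.
Qed.

Lemma card_small_links v (F : {set {set {set 'I_n}}}) :
  (forall L, L \in F -> L \subset touch [set v] (triples V) /\
      #|L|%:R <= 5 * mu * N ^+ 2) ->
  #|F|%:R <= 2 `^ (beta / 20 * N ^+ 2).
Proof.
move=> h; have c : #|touch [set v] (triples V)|%:R <= N ^+ 2.
  by rewrite -natrX ler_nat card_touch1_le.
apply: le_trans (few_mu c); rewrite ler_nat.
by apply/subset_leq_card/subsetP => L /h[s t]; rewrite inE s.
Qed.

(** Apart from a few edges meeting X, the link of y consists of pairs inside Y. There are about n^2
    / 18 of these, against about 2 n^2 / 9 slots at y. *)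
Lemma card_heavyY y : y \in V :\: X ->
  #|heavyY y|%:R <= 2 `^ (K [set y] - beta / 4 * N ^+ 2).
Proof.
move=> yV; have [yX _] : y \notin X /\ y \in V by move: yV; rewrite inE => /andP.
pose U := [set e : {set 'I_n} | e :&: X == set0].
apply: le_trans (_ : 2 `^ ('C(#|V :\: X|, 2)%:R + beta / 20 * N ^+ 2) <= _).
  apply: (@card_split_exp _ _ _
     (powerset [set e in touch [set y] (triples V) | e :\ y \subset V :\: X])
     [set L : {set {set 'I_n}} | (L \subset touch [set y] (triples V)) &&
        (#|L|%:R <= 5 * mu * N ^+ 2)] U).
  - move=> L; rewrite !inE => /andP[/subsetP LV _].
    apply/subsetP => e /setIP[/LV eL eU].
    have eX : e :&: X = set0 by move: eU; rewrite inE => /eqP.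
    rewrite inE eL /=; move: eL; rewrite touch1E inE => /andP[/andP[eV _] _].
    rewrite subsetD (subset_trans (subD1set _ _) eV) /= -setI_eq0 -subset0 -eX.
    by rewrite setSI // subD1set.
  - move=> L; rewrite !inE => /andP[LV].
    rewrite (subset_trans (subsetDl _ _) LV) /=.
    by congr (_%:R <= _); apply: eq_card => e; rewrite !inE andbC.
  - by apply: powerset_exp; rewrite ler_nat card_touch_sub_le.
  - by apply: (@card_small_links y) => L; rewrite inE => /andP.
apply: ler_exp2.
have k1 : 'C(#|X :&: V|, 2)%:R <= K [set y].
  rewrite ler_nat; apply: leq_trans (card_touch_slots_ge yV (subxx _)) _.
  by apply/subset_leq_card/subsetP => e; rewrite inE => /andP[].
apply: le_trans (_ : 'C(#|X :&: V|, 2)%:R - beta / 4 * N ^+ 2 <= _); last by rewrite lerD2r.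
rewrite !bin2R.
move: p_ge q_le n_ge2500 => p1 q1 N1.
have b1 : beta * N ^+ 2 <= 1 / 25 * N ^+ 2 by rewrite ler_wpM2r ?sqr_ge0.
have p2 : (66 / 100 * N) * (66 / 100 * N - 1) <= p * (p - 1) by apply: ler_pM; lra.
have q0 : 0 <= q by exact: ler0n.
have q2 : q * q <= (335 / 1000 * N) * (335 / 1000 * N) by apply: ler_pM.
have N2 : 2500 * N <= N ^+ 2 by rewrite expr2 ler_wpM2r.
move: p2 b1 N2; rewrite !expr2; lra.
Qed.

Lemma card_small_parts v (F : {set {set {set 'I_n}}}) (U : {set {set 'I_n}}) :
  (forall L, L \in F -> L \subset touch [set v] (triples V) /\
      #|[set e in L | e \in U]|%:R <= 5 * mu * N ^+ 2) ->
  #|[set L :&: U | L in F]|%:R <= 2 `^ (beta / 20 * N ^+ 2).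
Proof.
move=> h; apply: (@card_small_links v) => _ /imsetP[L /h[s t] ->]; split.
  by apply: subset_trans s; exact: subsetIl.
by apply: le_trans t; rewrite ler_nat; apply/subset_leq_card/subsetP => e; rewrite !inE.
Qed.

(** Once the independent set A is guessed, all slots formed by z and a pair inside A are absent.
    They number about alpha^2 n^2 / 2, at least beta n^2 / 2, which pays for the guess and for the
    few inconsistent edges and leaves beta n^2 / 4. *)
Lemma card_sparseY z : z \in V :\: X ->
  #|sparseY z|%:R <= 2 `^ (K [set z] - beta / 4 * N ^+ 2).
Proof.
move=> zV; have [zX _] : z \notin X /\ z \in V by move: zV; rewrite inE => /andP.
pose U := [set e : {set 'I_n} | #|e :&: X| != 2%N].
pose W A := [set e in touch [set z] (slots X V) | e :\ z \subset A].
pose S A := [set L in sparseY z |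
  [&& A \subset X :&: V, alpha * N <= #|A|%:R
        & [forall e in L, ~~ (e :\ z \subset A)]]].
have cov : sparseY z \subset \bigcup_(A | A \in powerset [set: 'I_n]) S A.
  apply/subsetP => L LS; move: (LS); rewrite inE => /and3P[_ _ /existsP[A hA]].
  by apply/bigcupP; exists A; [rewrite inE subsetT|rewrite in_set LS].
have cS A : #|S A|%:R <= 2 `^ (beta / 20 * N ^+ 2 +
                              (K [set z] - (alpha * N) * (alpha * N - 1) / 2)).
  have [/andP[AXV Ale]|no] := boolP ((A \subset X :&: V) && (alpha * N <= #|A|%:R)); last first.
    rewrite (_ : S A = set0) ?cards0 ?exp2_ge0 //.
    apply/setP => L; rewrite !inE; apply/negP => /and4P[_ h1 h2 _].
    by rewrite h1 h2 in no.
  apply: (@card_split_exp _ _ _ [set L :&: U | L in S A]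
    (powerset (touch [set z] (slots X V) :\: W A)) U).
  - by move=> L LS; exact: imset_f.
  - move=> L; rewrite inE => /andP[]; rewrite inE => /and3P[/subsetP LV _ _].
    move=> /and3P[_ _ /forallP hA]; rewrite inE; apply/subsetP => e /setDP[eL].
    rewrite inE negbK => eX.
    have := hA e; rewrite eL /= => /negbTE eA.
    have := LV _ eL; rewrite touch1E => /andP[eV ze].
    by rewrite inE /W inE eA andbF /= touch1E inE eV eX ze.
  - apply: (@card_small_parts z) => L; rewrite inE => /andP[]; rewrite inE.
    move=> /and3P[LV h _] _; split=> //.
    suff -> : [set e in L | e \in U] = [set e in L | #|e :&: X| != 2%N] by [].
    by apply/setP => e; rewrite !inE.
  - apply: powerset_exp; have Wsub : W A \subset touch [set z] (slots X V).
      by apply/subsetP => e; rewrite inE => /andP[].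
    rewrite cardsDS // natrB ?subset_leq_card // lerD2l lerN2.
    apply: le_trans (_ : 'C(#|A|, 2)%:R <= _); last first.
      by rewrite ler_nat card_touch_slots_ge.
    rewrite bin2R ler_pM2r ?invr_gt0 ?ltr0n //.
    have a1 : 1 <= alpha * N.
      move: n_ge2500 alpha01 beta_alpha n_large => N1 /andP[a0 a1] ba nl.
      have : 100 <= alpha * N; last by move=> ?; lra.
      apply: le_trans nl _; rewrite ler_wpM2r //.
      by apply: le_trans ba _; rewrite expr2 ger_pMr.
    by apply: ler_pM; lra.
have N0 : 0 <= N by exact: ler0n.
have cT : #|[set: 'I_n]|%:R <= N by rewrite cardsT card_ord.
apply: le_trans (_ : #|\bigcup_(A | A \in powerset [set: 'I_n]) S A|%:R <= _).
  by rewrite ler_nat; exact: subset_leq_card.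
apply: le_trans (card_bigcup_powerset_exp cT (fun A _ => cS A)) _.
apply: ler_exp2.
move: n_ge2500 N_le_sqr alpha01 beta_alpha => N1 N2 /andP[a0 a1] ba.
have h : beta * N ^+ 2 <= alpha ^+ 2 * N ^+ 2 by rewrite ler_wpM2r ?sqr_ge0.
have h2 : alpha * N <= N by rewrite ger_pMl //; lra.
move: h h2 N2; rewrite !expr2; lra.
Qed.

(** Let M, of size m, be the set of vertices of Y in XYY-edges at x. These edges use only pairs
    inside M, about m^2 / 2 <= nm / 6 of them, whereas about 2nm / 3 slots at x meet M, and at each
    vertex of M all but alpha n of these are absent. The net gain of about nm / 2 is quadratic
    because m^2 / 2 is at least beta n^2. *)
Lemma card_heavyX x : x \in X :&: V ->
  #|heavyX x|%:R <= 2 `^ (K [set x] - beta / 4 * N ^+ 2).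
Proof.
move=> xXV; have [xX xV] : x \in X /\ x \in V by move: xXV; rewrite inE => /andP.
pose U3 := [set e : {set 'I_n} | #|e :&: X| == 3%N].
pose U1 := [set e : {set 'I_n} | #|e :&: X| == 1%N].
pose U2 M := [set e : {set 'I_n} | ~~ [disjoint e & M]].
pose W M := [set e in touch [set x] (slots X V) | ~~ [disjoint e & M]].
pose Mof L := [set y in V :\: X | [exists e in L, (#|e :&: X| == 1%N) && (y \in e)]].
pose S M := [set L in heavyX x | Mof L == M].
have cov : heavyX x \subset \bigcup_(M | M \in powerset [set: 'I_n]) S M.
  apply/subsetP => L LS.
  by apply/bigcupP; exists (Mof L); [rewrite inE subsetT|rewrite in_set LS eqxx].
have SP M L : L \in S M -> [/\ L \subset touch [set x] (triples V),
    #|[set e in L | #|e :&: X| == 3%N]|%:R <= 5 * mu * N ^+ 2,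
    beta * N ^+ 2 <= #|[set e in L | #|e :&: X| == 1%N]|%:R,
    Mof L = M & forall y, y \in M ->
      #|[set e in L | (#|e :&: X| == 2%N) && (y \in e)]|%:R <= alpha * N].
  rewrite in_set => /andP[]; rewrite in_set => /and4P[h1 h2 h3 /forallP h4] /eqP h5.
  split=> // y; rewrite -h5 in_set => /andP[yV he].
  by have := h4 y; rewrite yV he.
have typ e : e \in touch [set x] (triples V) -> (0 < #|e :&: X| <= 3)%N.
  rewrite touch1E inE => /andP[/andP[_ /eqP e3] xe].
  rewrite -e3 subset_leq_card ?subsetIl // andbT card_gt0.
  by apply/set0Pn; exists x; rewrite inE xe.
have e1M M L e : L \in S M -> e \in L -> e \in U1 ->
    e \in [set e in touch [set x] (triples V) | e :\ x \subset M].
  move=> /SP[/subsetP LV _ _ <- _] eL; rewrite inE => e1.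
  have eT := LV _ eL; rewrite inE eT /=.
  have [eV xe] : e \subset V /\ x \in e.
    by move: eT; rewrite touch1E inE => /andP[/andP[]].
  apply/subsetP => y; rewrite !inE => /andP[yx ye].
  rewrite (subsetP eV) // andbT; apply/andP; split.
    apply: contra yx => yX; have /cards1P[w E] := e1.
    have : y \in e :&: X by rewrite inE ye.
    have : x \in e :&: X by rewrite inE xe.
    by rewrite E !inE => /eqP-> /eqP->.
  by apply/existsP; exists e; rewrite eL e1.
have N0 : 0 <= N by exact: ler0n.
(* The spare [- N] pays for the union over the candidate sets [M]. *)
have cS M : #|S M|%:R <= 2 `^ (K [set x] - beta / 4 * N ^+ 2 - N).
  (* The size bounds on [M] are read off a member of the fiber, so the empty fiber is treated
     apart. *)
  have [->|/set0Pn[L0 L0S]] := eqVneq (S M) set0; first by rewrite cards0 exp2_ge0.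
  have MY : M \subset V :\: X.
    by have [_ _ _ <- _] := SP _ _ L0S; apply/subsetP => y; rewrite inE => /andP[].
  pose m := #|M|%:R : R.
  have m0 : 0 <= m by exact: ler0n.
  have m_q : m <= q by rewrite ler_nat subset_leq_card.
  have mbig : beta * N ^+ 2 <= m * (m - 1) / 2.
    have [_ _ h _ _] := SP _ _ L0S; apply: le_trans h _; rewrite -bin2R ler_nat.
    apply: leq_trans (card_touch_sub_le V x M).
    apply/subset_leq_card/subsetP => e; rewrite inE => /andP[eL e1].
    by apply: (e1M _ _ _ L0S eL); rewrite inE.
  have Wbig : (p - 1) * m <= #|W M|%:R.
    have p0 : (0 < #|X :&: V|)%N by rewrite card_gt0; apply/set0Pn; exists x.
    have -> : p - 1 = #|X :&: V|.-1%:R by rewrite -subn1 natrB.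
    by rewrite -natrM ler_nat; apply: card_touch_slots_meet_ge.
  have Wsub : W M \subset touch [set x] (slots X V).
    by apply/subsetP => e; rewrite inE => /andP[].
  (* The four summands pay for the XXX-edges, the XYY-edges inside [M], the slots meeting [M] (N /
     100 for each vertex of [M]) and the remaining slots. *)
  apply: le_trans (_ : 2 `^ (beta / 20 * N ^+ 2 + (m * (m - 1) / 2 +
      (1 / 100 * N * m + (K [set x] - #|W M|%:R)))) <= _); last first.
    apply: ler_exp2.
    move: n_ge2500 N_le_sqr p_ge q_le n_large => N1 N2 p1 q1 nl.
    have h1 : (66 / 100 * N - 1) * m <= (p - 1) * m by rewrite ler_wpM2r // lerD2r.
    have h2 : m * m <= 335 / 1000 * N * m by rewrite ler_wpM2r //; lra.
    have h3 : 2500 * m <= N * m by rewrite ler_wpM2r.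
    move: mbig h1 h2 h3 Wbig N2; rewrite !expr2; lra.
  apply: (@card_split_exp _ _ _ [set L :&: U3 | L in S M]
           [set L :\: U3 | L in S M] U3).
  - by move=> L LS; exact: imset_f.
  - by move=> L LS; exact: imset_f.
  - apply: (@card_small_parts x) => L /SP[LV h _ _ _]; split=> //.
    suff -> : [set e in L | e \in U3] = [set e in L | #|e :&: X| == 3%N] by [].
    by apply/setP => e; rewrite !inE.
  apply: (@card_split_exp _ _ _
    (powerset [set e in touch [set x] (triples V) | e :\ x \subset M])
    [set L :\: U3 :\: U1 | L in S M] U1).
  - move=> _ /imsetP[L LS ->]; rewrite inE; apply/subsetP => e /setIP[/setDP[eL _] e1].
    exact: e1M LS eL e1.
  - by move=> _ /imsetP[L LS ->]; exact: imset_f.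
  - by apply: powerset_exp; rewrite /m -bin2R ler_nat card_touch_sub_le.
  have e2slot L e : L \in S M -> e \in L :\: U3 :\: U1 ->
      e \in L /\ e \in touch [set x] (slots X V).
    move=> /SP[/subsetP LV _ _ _ _]; rewrite !in_setD => /and3P[n1 n3 eL].
    split=> //; have eT := LV _ eL; have := typ _ eT.
    move: n1 n3 eT; rewrite 2!inE !touch1E => n1 n3 /andP[eV ->].
    rewrite andbT inE eV /=.
    by case: #|_| n1 n3 => [|[|[|[|]]]].
  apply: (@card_split_exp _ _ _ [set (L :\: U3 :\: U1) :&: U2 M | L in S M]
    (powerset (touch [set x] (slots X V) :\: W M)) (U2 M)).
  - by move=> _ /imsetP[L LS ->]; exact: (imset_f (fun L => (L :\: U3 :\: U1) :&: U2 M)).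
  - move=> _ /imsetP[L LS ->]; rewrite inE; apply/subsetP => e /setDP[eL eU].
    have [_ es] := e2slot _ _ LS eL; rewrite inE es andbT.
    by apply: contra eU; rewrite !inE => /andP[].
  - have -> : 1 / 100 * N * m = \sum_(y in M) (1 / 100 * N).
      by rewrite sumr_const mulr_natr.
    rewrite (big_morph (fun a : R => 2 `^ a) (exp2D (R := R)) (powRr0 2)).
    pose F' y := [set L in powerset [set e in touch [set x] (triples V) | y \in e] |
                     #|L|%:R <= alpha * N].
    apply: le_trans (_ : (\prod_(y in M) #|F' y|)%:R <= _).
      rewrite ler_nat; apply: (@card_cover_le _ _ _ _ (fun y => [set e : {set 'I_n} | y \in e])).
        move=> _ /imsetP[L LS ->]; apply/subsetP => e /setIP[_].
        rewrite inE => /pred0Pn[y /= /andP[ye yM]].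
        by apply/bigcupP; exists y; rewrite ?inE.
      move=> _ y /imsetP[L LS ->] yM.
      have [LV _ _ _ /(_ y yM) h] := SP _ _ LS.
      rewrite 2!inE; apply/andP; split.
        apply/subsetP => e /setIP[/setIP[eL _] eU].
        have ye : y \in e by move: eU; rewrite inE.
        have [eL' _] := e2slot _ _ LS eL.
        by rewrite inE ye andbT (subsetP LV).
      apply: le_trans h; rewrite ler_nat; apply/subset_leq_card/subsetP => e.
      move=> /setIP[/setIP[eL _] eU].
      have ye : y \in e by move: eU; rewrite inE.
      have [e1 e2] := e2slot _ _ LS eL; rewrite inE e1 ye andbT /=.
      by move: e2; rewrite touch1E => /andP[]; rewrite inE => /andP[].
    rewrite natr_prod; apply: ler_prod => y yM; rewrite ler0n /=.
    have yx : x != y.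
      by apply: contraTneq yM => <-; apply/negP => /(subsetP MY); rewrite inE xX.
    have c : #|[set e in touch [set x] (triples V) | y \in e]|%:R <= N.
      by rewrite ler_nat card_touch2_le.
    apply: le_trans (few_alpha c); rewrite ler_nat.
    by apply/subset_leq_card/subsetP => L; rewrite !inE.
  - by apply: powerset_exp; rewrite cardsDS // natrB ?subset_leq_card.
have cT : #|[set: 'I_n]|%:R <= N by rewrite cardsT card_ord.
apply: le_trans (_ : #|\bigcup_(M | M \in powerset [set: 'I_n]) S M|%:R <= _).
  by rewrite ler_nat; exact: subset_leq_card.
apply: le_trans (card_bigcup_powerset_exp cT (fun M _ => cS M)) _.
by apply: ler_exp2; lra.
Qed.

(** Since 7^6 <= 2^17, a block of three slots with one forbidden subset costs 17/6 instead of 3 in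
    the exponent, a saving of 1/6. *)
Lemma exp2_seven_eighths (a k : nat) : (3 * a <= k)%N ->
  (7 ^ a * 2 ^ (k - 3 * a))%:R <= 2 `^ (k%:R - a%:R / 6) :> R.
Proof.
move=> ak; have h7 : 7 <= 2 `^ (17 / 6) :> R.
  rewrite -(@ler_pXn2r _ 6) ?nnegrE ?exp2_ge0 ?ler0n // exp2X.
  have -> : 17 / 6 * 6%:R = 17%:R :> R by rewrite mulfVK // pnatr_eq0.
  by rewrite -exp2_nat -natrX ler_nat.
rewrite natrM natrX exp2_nat natrB //.
apply: le_trans (_ : (2 `^ (17 / 6)) ^+ a * 2 `^ (k%:R - (3 * a)%:R) <= _).
  by rewrite ler_wpM2r ?exp2_ge0 // lerXn2r ?nnegrE ?exp2_ge0 ?ler0n.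
rewrite exp2X -exp2D; apply: ler_exp2; rewrite natrM; lra.
Qed.

(** For r in [P] the three slots joining r to a vertex of T cannot all be present, and the blocks
    are disjoint because r is recovered by removing T. The n^2 / 6 blocks save n^2 / 36; the
    inconsistent edges meeting T cost n^2 / 100. *)
Lemma card_monoEdge_blocks T (P : {set {set 'I_n}}) : T \in triples V ->
  P \subset pairs_in (V :\: T) ->
  (forall p t, p \in P -> t \in T -> #|(t |: p) :&: X| = 2%N) ->
  N ^+ 2 / 6 <= #|P|%:R ->
  #|monoEdge T|%:R <= 2 `^ (K T - beta / 4 * N ^+ 2).
Proof.
rewrite inE => /andP[TV /eqP T3] /subsetP PV P2 Pbig.
pose U := [set e : {set 'I_n} | #|e :&: X| != 2%N].
pose B (r : {set 'I_n}) := [set t |: r | t in T].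
have dis r t : r \in P -> t \in T -> t \notin r /\ (t |: r) :\: T = r.
  move=> /PV; rewrite inE subsetD => /andP[/andP[_ d] _] tT.
  split; first by rewrite (disjointFl d).
  rewrite setDUl (_ : [set t] :\: T = set0) ?set0U; last first.
    by apply/eqP; rewrite setD_eq0 sub1set.
  by apply/setDidPl.
have blocks r : r \in P -> B r \subset touch T (slots X V) /\ #|B r| = 3%N.
  move=> rP; split; last first.
    rewrite card_in_imset // => t t' tT t'T e.
    have : t \in t' |: r by rewrite -e setU11.
    by rewrite !inE (negbTE (dis _ _ rP tT).1) orbF => /eqP.
  apply/subsetP => _ /imsetP[t tT ->]; have [tr _] := dis _ _ rP tT.
  have := PV _ rP; rewrite inE subsetD => /andP[/andP[rV _] /eqP r2].
  rewrite inE; apply/andP; split; last first.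
    by apply/pred0Pn; exists t; rewrite /= tT setU11.
  rewrite inE P2 // eqxx andbT inE subUset sub1set rV (subsetP TV) //=.
  by rewrite cardsU1 tr r2.
apply: le_trans (_ : 2 `^ (1 / 300 * (3 * N ^+ 2) + (K T - #|P|%:R / 6)) <= _); last first.
  apply: ler_exp2; have : beta * N ^+ 2 <= 1 / 25 * N ^+ 2.
    by rewrite ler_wpM2r // sqr_ge0.
  by move: Pbig (sqr_ge0 N); rewrite !expr2; lra.
have cT : #|touch T (triples V)|%:R <= 3 * N ^+ 2.
  by rewrite -natrX -natrM ler_nat -T3 card_touch_le.
apply: (@card_split_exp _ _ _ [set L : {set {set 'I_n}} | (L \subset touch T (triples V)) &&
    (#|L|%:R <= 6 * beta * (3 * N ^+ 2))] [set L :\: U | L in monoEdge T] U).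
- move=> L; rewrite !in_set => /and3P[LV h _].
  rewrite (subset_trans (subsetIl _ _) LV) /=.
  have -> : 6 * beta * (3 * N ^+ 2) = 18 * beta * N ^+ 2 by ring.
  by apply: le_trans h; rewrite ler_nat; apply/subset_leq_card/subsetP => e; rewrite !inE.
- by move=> L LS; exact: imset_f.
- exact: few_beta cT.
have [] := @card_missing_blocks _ _ P B (touch T (slots X V)) [set L :\: U | L in monoEdge T].
- by [].
- move=> r r' rP r'P ne; rewrite -setI_eq0; apply/negPn/negP => /set0Pn[e].
  rewrite inE => /andP[/imsetP[t tT ->] /imsetP[t' t'T E]].
  by move: ne; rewrite -(dis _ _ rP tT).2 E (dis _ _ r'P t'T).2 eqxx.
- move=> _ /imsetP[L + ->]; rewrite in_set => /and3P[/subsetP LV _ /forallP hL]; split.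
    apply/subsetP => e /setDP[/LV eT]; rewrite inE negbK => e2.
    by move: eT; rewrite !inE e2 => /andP[-> ->].
  move=> r rP; have := hL r; rewrite PV //=; apply: contra => /subsetP BL.
  apply/forallP => t; apply/implyP => tT.
  by have := BL _ (imset_f (fun t => t |: r) tT); rewrite inE => /andP[].
move=> h1 h2; apply: le_trans (exp2_seven_eighths h2); by rewrite ler_nat.
Qed.

(** The pairs must make every triple of a block a slot: one vertex from each part when T lies in X,
    two vertices of X when T lies in Y. Either way there are about 2 n^2 / 9 pairs, more than the
    required n^2 / 6. *)
Lemma card_monoEdge T : T \in triples V -> T \subset X \/ [disjoint T & X] ->
  #|monoEdge T|%:R <= 2 `^ (K T - beta / 4 * N ^+ 2).
Proof.
move=> TV; have T3 : #|T| = 3%N by move: TV; rewrite inE => /andP[_ /eqP].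
move: p_ge q_ge n_ge2500 => p1 q1 N1.
have N2 : 2500 * N <= N ^+ 2 by rewrite expr2 ler_wpM2r.
case=> [TX|dTX].
  pose D := setX ((X :&: V) :\: T) (V :\: X).
  pose f (r : 'I_n * 'I_n) := [set r.1; r.2].
  have DP r : r \in D -> [/\ r.1 \in X, r.1 \in V, r.1 \notin T, r.2 \notin X & r.2 \in V].
    by case: r => a b; rewrite in_setX !inE /= => /andP[/and3P[-> -> ->] /andP[-> ->]].
  apply: (@card_monoEdge_blocks T (f @: D)) => //.
  - apply/subsetP => _ /imsetP[[a b] /DP[/= aX aV aT bX bV] ->].
    rewrite inE cards2 subUset !sub1set !inE aT aV bV !andbT /=.
    have ab : a != b by apply: contraNneq bX => <-.
    by rewrite ab eqxx (contra (subsetP TX b)).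
  - move=> _ t /imsetP[[a b] /DP[/= aX aV aT bX bV] ->] tT.
    rewrite /f /= setUA; apply: set3_meet2 => //; first exact: (subsetP TX).
    by apply: contraNneq aT => ->.
  - rewrite card_in_imset; last first.
      move=> [a b] [a' b'] /DP[/= aX aV aT bX bV] /DP[/= a'X a'V a'T b'X b'V] E.
      have: a \in [set a'; b'] by rewrite -[[set a'; b']]E !inE eqxx.
      have: b \in [set a'; b'] by rewrite -[[set a'; b']]E !inE eqxx orbT.
      rewrite !inE => hb ha; congr pair.
        by case/orP: ha => /eqP // e; rewrite e (negbTE b'X) in aX.
      by case/orP: hb => /eqP // e; rewrite e a'X in bX.
    rewrite cardsX natrM cardsD (setIidPr (_ : T \subset X :&: V)); last first.
      by rewrite subsetI TX; move: TV; rewrite inE => /andP[].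
    rewrite T3 natrB; last first.
      by rewrite -(@ler_nat R); lra.
    have h : (66 / 100 * N - 3) * (33 / 100 * N) <= (p - 3) * q by apply: ler_pM; lra.
    by apply: le_trans h; move: N2; rewrite expr2; lra.
apply: (@card_monoEdge_blocks T (pairs_in (X :&: V))) => //.
- apply/subsetP => r; rewrite !inE subsetI => /andP[/andP[rX rV] ->].
  by rewrite subsetD rV andbT disjoint_sym /= (disjointWr rX).
- move=> r t; rewrite inE subsetI => /andP[/andP[rX _] /eqP r2] tT.
  rewrite setIUl (setIidPl rX) disjoint_setI0 ?set0U //.
  by rewrite disjoints1 (disjointFr dTX).
- rewrite card_pairs_in bin2R.
  have h : (66 / 100 * N) * (66 / 100 * N - 1) <= p * (p - 1) by apply: ler_pM; lra.
  by move: h N2; rewrite expr2; lra.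
Qed.

End Families.

(** * Inconsistent edges through thin pairs *)

Lemma double_count (A B : finType) (P : {set A}) (Q : {set B})
    (I : A -> B -> bool) :
  (\sum_(a in P) #|[set b in Q | I a b]| =
   \sum_(b in Q) #|[set a in P | I a b]|)%N.
Proof.
transitivity (\sum_(a in P) \sum_(b in Q) I a b)%N.
  apply: eq_bigr => a _; rewrite -sum1_card big_mkcond [RHS]big_mkcond /=.
  by apply: eq_bigr => b _; rewrite inE; case: (b \in Q); case: (I a b).
rewrite exchange_big /=; apply: eq_bigr => b _.
rewrite -sum1_card big_mkcond [RHS]big_mkcond /=.
by apply: eq_bigr => a _; rewrite inE; case: (a \in P); case: (I a b).
Qed.

Section ThinPairs.
Variables (n : nat) (X V : {set 'I_n}) (M : {set 'I_n * 'I_n}).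
Hypothesis MXY : M \subset setX (X :&: V) (V :\: X).
Implicit Types (e : {set 'I_n}) (r : 'I_n * 'I_n).
Local Notation inc r e := ((r.1 \in e) && (r.2 \in e)).

(** When [M] is exactly the set of XY-pairs inside XYY-edges of a graph, all its XYY-edges lie in
    this set. *)
Definition forcedYY : {set {set 'I_n}} :=
  [set e in triples V | (#|e :&: X| == 1%N) &&
    [forall r in setX (X :&: V) (V :\: X), inc r e ==> (r \in M)]].

Definition thinSlots : {set {set 'I_n}} :=
  [set e in slots X V | [exists r in M, inc r e]].

Lemma pairP r : r \in M ->
  [/\ r.1 \in X, r.1 \in V, r.2 \notin X & r.2 \in V].
Proof.
by case: r => x y /(subsetP MXY); rewrite in_setX !inE => /andP[/andP[-> ->] /andP[-> ->]].
Qed.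

Lemma card_setD_X e : #|e| = 3%N -> #|e :\: X| = (3 - #|e :&: X|)%N.
Proof. by move=> e3; rewrite -e3 -(cardsID X e) addKn. Qed.

(** A forced triple xyz through the pair xy puts xz into [M] as well. So z is a vertex of Y and is
    also determined by a member of [M]; the first bound serves large [M], the second small [M]. *)
Lemma forcedYY_deg r : r \in M ->
  (#|[set e in forcedYY | inc r e]| <= minn #|V :\: X| #|M|)%N.
Proof.
move=> rM; have [xX xV yX yV] := pairP rM.
pose Z := [set z in V :\: X | (r.1, z) \in M].
apply: leq_trans (_ : #|Z| <= _)%N; last first.
  rewrite leq_min; apply/andP; split.
    by apply/subset_leq_card/subsetP => z; rewrite inE => /andP[].
  rewrite -(card_in_imset (f := fun z => (r.1, z)) (D := mem Z)); last first.
    by move=> z z' _ _ [].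
  by apply/subset_leq_card/subsetP => _ /imsetP[z + ->]; rewrite inE => /andP[].
apply: leq_trans (leq_imset_card (fun z => [set r.1; r.2; z]) _).
apply/subset_leq_card/subsetP => e; rewrite in_set => /andP[+ /andP[xe ye]].
rewrite in_set => /and3P[eV /eqP e1 /forallP h].
have [eV' e3] : e \subset V /\ #|e| = 3%N by move: eV; rewrite inE => /andP[-> /eqP].
have xy : r.1 != r.2 by apply: contraNneq yX => <-.
have : (0 < #|e :\: X :\ r.2|)%N.
  have := card_setD_X e3; rewrite e1 (cardsD1 r.2) in_setD yX ye add1n => -[->].
  by [].
rewrite card_gt0 => /set0Pn[z]; rewrite !inE => /and3P[zy zX ze].
apply/imsetP; exists z.
  rewrite !inE zX (subsetP eV' _ ze) /=.
  by have := h (r.1, z); rewrite in_setX !inE xX xV zX (subsetP eV' _ ze) xe ze.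
apply/esym/eqP; rewrite eqEcard e3; apply/andP; split.
  by apply/subsetP => u; rewrite !inE => /orP[/orP[]|] /eqP->.
have xz : r.1 != z by apply: contraNneq zX => <-.
by rewrite -setUA cardsU1 cardsU1 cards1 !inE (negbTE xy) (negbTE xz) eq_sym zy.
Qed.

Lemma card_forcedYY : (2 * #|forcedYY| <= #|M| * minn #|V :\: X| #|M|)%N.
Proof.
apply: leq_trans (_ : \sum_(e in forcedYY) #|[set r in M | inc r e]| <= _)%N.
  rewrite mulnC -sum_nat_const; apply: leq_sum => e.
  rewrite in_set => /and3P[eV /eqP e1 /forallP h].
  have [/subsetP eV' e3] : e \subset V /\ #|e| = 3%N by move: eV; rewrite inE => /andP[-> /eqP].
  have <- : #|setX (e :&: X) (e :\: X)| = 2%N by rewrite cardsX card_setD_X ?e1.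
  apply/subset_leq_card/subsetP => -[x y]; rewrite in_setX !inE => /andP[/andP[xe xX] /andP[yX ye]].
  have := h (x, y); rewrite in_setX !inE /= xX yX xe ye !eV' //= => ->.
  by [].
rewrite -double_count -sum_nat_const; apply: leq_sum => r; exact: forcedYY_deg.
Qed.

Lemma thinSlots_deg r : r \in M ->
  (#|X :&: V|.-1 <= #|[set e in thinSlots | inc r e]|)%N.
Proof.
move=> rM; have [xX xV yX yV] := pairP rM.
have h1 : r.1 \in X :&: V by rewrite inE xX.
have h2 : [set r.2] \subset V :\: X by rewrite sub1set inE yX.
have := card_touch_slots_meet_ge h1 h2; rewrite cards1 muln1 => h; apply: leq_trans h _.
apply/subset_leq_card/subsetP => e; rewrite in_set touch1E => /andP[/andP[es xe]].
rewrite disjoint_sym disjoints1 negbK => ye.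
rewrite in_set xe ye in_set es !andbT /=.
by apply/existsP; exists r; rewrite rM xe ye.
Qed.

Lemma thinSlots_pairs e : e \in thinSlots ->
  (0 < #|[set r in M | inc r e]| <= 2)%N.
Proof.
rewrite in_set => /andP[es /existsP[r /andP[rM re]]]; apply/andP; split.
  by rewrite card_gt0; apply/set0Pn; exists r; rewrite in_set rM.
move: es; rewrite 2!in_set => /andP[/andP[_ /eqP e3] /eqP e2].
have <- : #|setX (e :&: X) (e :\: X)| = 2%N by rewrite cardsX card_setD_X ?e2.
apply/subset_leq_card/subsetP => -[x y]; rewrite in_set in_setX !inE.
by move=> /andP[/pairP[/= -> _ -> _] /andP[-> ->]].
Qed.

(** A slot contains only two XY-pairs, so it is counted at most twice. *)
Lemma card_thinSlots_ge : (#|M| * #|X :&: V|.-1 <= 2 * #|thinSlots|)%N.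
Proof.
apply: leq_trans (_ : \sum_(e in thinSlots) #|[set r in M | inc r e]| <= _)%N.
  by rewrite -double_count -sum_nat_const; apply: leq_sum => r; exact: thinSlots_deg.
rewrite mulnC -sum_nat_const; apply: leq_sum => e /thinSlots_pairs.
by case/andP.
Qed.

(** Two pairs of [M] in a common slot share its Y-vertex and determine the slot, so at most |M|^2
    slots are counted twice. For small [M] this avoids losing the factor 2, without which two thin
    pairs would not gain more than n. *)
Lemma card_thinSlots_ge_sparse :
  (#|M| * #|X :&: V|.-1 <= #|thinSlots| + #|M| ^ 2)%N.
Proof.
pose D := [set e in thinSlots | 1 < #|[set r in M | inc r e]|]%N.
have DM : (#|D| <= #|M| ^ 2)%N.
  rewrite -mulnn -cardsX.
  apply: leq_trans (leq_imset_card (fun s => [set s.1.1; s.2.1; s.1.2]) _).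
  apply/subset_leq_card/subsetP => e; rewrite in_set => /andP[eT].
  case/card_gt1P => r [r' [rI r'I rr']].
  move: eT; rewrite 3!in_set => /andP[/andP[/andP[_ /eqP e3] /eqP e2] _].
  move: rI r'I; rewrite !in_set => /andP[rM /andP[xe ye]] /andP[r'M /andP[x'e y'e]].
  have [xX xV yX yV] := pairP rM; have [x'X x'V y'X y'V] := pairP r'M.
  have /eqP/cards1P[y E] : #|e :\: X| = 1%N by rewrite card_setD_X ?e2.
  have yy : r'.2 = r.2.
    have : r.2 \in e :\: X by rewrite inE yX.
    have : r'.2 \in e :\: X by rewrite inE y'X.
    by rewrite E !inE => /eqP-> /eqP->.
  have xx : r.1 != r'.1.
    apply: contraNneq rr' => xx; apply/eqP.
    by rewrite (surjective_pairing r) (surjective_pairing r') xx yy.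
  apply/imsetP; exists (r, r'); first by rewrite in_setX rM.
  apply/esym/eqP; rewrite eqEcard e3; apply/andP; split.
    by apply/subsetP => u; rewrite !inE => /orP[/orP[]|] /eqP->.
  have n1 : r.1 != r.2 by apply: contraNneq yX => <-.
  have n2 : r'.1 != r.2 by apply: contraNneq yX => <-.
  by rewrite /= -setUA cardsU1 cardsU1 cards1 !inE (negbTE xx) (negbTE n1) (negbTE n2).
apply: leq_trans (leq_add (leqnn _) DM).
apply: leq_trans (_ : \sum_(e in thinSlots) #|[set r in M | inc r e]| <= _)%N.
  by rewrite -double_count -sum_nat_const; apply: leq_sum => r; exact: thinSlots_deg.
have -> : (#|D| = \sum_(e in thinSlots) (1 < #|[set r in M | inc r e]|))%N.
  rewrite -sum1_card big_mkcond [RHS]big_mkcond /=; apply: eq_bigr => e _.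
  by rewrite [e \in D]in_set; case: (e \in _) => //=; case: (1 < _)%N.
rewrite -sum1_card -big_split /=; apply: leq_sum => e /thinSlots_pairs.
by case: #|_| => [|[|[|]]].
Qed.

End ThinPairs.

(** * Traces whose inconsistent edges all have type XYY and thin pairs *)

Section CleanCount.
Variables (R : realType) (n : nat) (X V : {set 'I_n}) (alpha : R).
Local Notation N := (@GRing.natmul R 1 n).
Local Notation p := (@GRing.natmul R 1 #|X :&: V|).
Local Notation q := (@GRing.natmul R 1 #|V :\: X|).
Local Notation S := (@GRing.natmul R 1 #|slots X V|).
Implicit Types (x y z : 'I_n) (e : {set 'I_n}) (G : {set {set 'I_n}}).

Definition clean : {set {set {set 'I_n}}} :=
  [set G : {set {set 'I_n}} | [&& G \subset triples V,
     [forall e in G, (#|e :&: X| == 1%N) || (#|e :&: X| == 2%N)] &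
     [forall x in X :&: V, forall y in V :\: X,
        [exists e in G, [&& #|e :&: X| == 1%N, x \in e & y \in e]] ==>
        (#|[set e in G | [&& #|e :&: X| == 2%N, x \in e & y \in e]]|%:R
           <= alpha * N)]]].

(** In a clean graph these pairs have codegree at most alpha n in X, hence the name. *)
Definition thinPairs G : {set 'I_n * 'I_n} :=
  [set r in setX (X :&: V) (V :\: X) |
     [exists e in G, [&& #|e :&: X| == 1%N, r.1 \in e & r.2 \in e]]].

Hypothesis few_alpha : few_small (1 / 100) alpha.
Hypothesis p_ge : 66 / 100 * N <= p.
Hypothesis q_le : q <= 335 / 1000 * N.
Hypothesis lg_small : lg R n <= 1 / 1000 * N.
Hypothesis n_large : 4000 <= N.

Lemma cleanP G : G \in clean ->
  [/\ G \subset triples V,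
      forall e, e \in G -> #|e :&: X| = 1%N \/ #|e :&: X| = 2%N &
      forall r, r \in thinPairs G ->
        #|[set e in G | [&& #|e :&: X| == 2%N, r.1 \in e & r.2 \in e]]|%:R
           <= alpha * N].
Proof.
rewrite in_set => /and3P[GV /forallP h1 /forallP h2]; split=> //.
  by move=> e eG; have := h1 e; rewrite eG /= => /orP[] /eqP; [left|right].
case=> x y; rewrite in_set in_setX => /andP[/andP[xV yV] ex].
by have := h2 x; rewrite xV => /forallP/(_ y); rewrite yV /=; move: ex => /= ->.
Qed.

(** Fixing the set of thin pairs confines the XYY-edges to [forcedYY], leaves 2^(n / 100) choices
    for the slots through each pair, and does not restrict the other slots. *)
Lemma card_thinPairs_fiber (M : {set 'I_n * 'I_n}) :
  M \subset setX (X :&: V) (V :\: X) ->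
  #|[set G in clean | thinPairs G == M]|%:R <=
  2 `^ (#|forcedYY X V M|%:R + (1 / 100 * N * #|M|%:R +
         (S - #|thinSlots X V M|%:R))) :> R.
Proof.
move=> MXY; pose U1 := [set e : {set 'I_n} | #|e :&: X| == 1%N].
pose U2 := [set e : {set 'I_n} | [exists r in M, (r.1 \in e) && (r.2 \in e)]].
set F := [set G in clean | _].
have FP G : G \in F -> G \in clean /\ thinPairs G = M by rewrite inE => /andP[-> /eqP].
apply: (@card_split_exp _ _ _ (powerset (forcedYY X V M)) [set G :\: U1 | G in F] U1).
- move=> G /FP[/cleanP[/subsetP GV h1 _] <-]; rewrite inE.
  apply/subsetP => e /setIP[eG]; rewrite inE => e1.
  rewrite inE GV // e1 /=; apply/forallP => r; apply/implyP => rV.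
  apply/implyP => re; rewrite inE rV /=; apply/existsP; exists e.
  by rewrite eG e1.
- by move=> G GF; exact: imset_f.
- exact: powerset_exp.
have e2slot G e : G \in F -> e \in G :\: U1 -> e \in G /\ e \in slots X V.
  move=> /FP[/cleanP[/subsetP GV h1 _] _] /setDP[eG]; rewrite inE => e1.
  split=> //; rewrite inE GV //=; case: (h1 _ eG) => [e1'|-> //].
  by rewrite e1' in e1.
apply: (@card_split_exp _ _ _ [set (G :\: U1) :&: U2 | G in F]
    (powerset (slots X V :\: thinSlots X V M)) U2).
- by move=> _ /imsetP[G GF ->]; exact: (imset_f (fun G => (G :\: U1) :&: U2)).
- move=> _ /imsetP[G GF ->]; rewrite inE; apply/subsetP => e /setDP[eL eU].
  have [_ es] := e2slot _ _ GF eL; rewrite inE es andbT.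
  apply: contra eU; rewrite !inE => /andP[_] /existsP[r hr].
  by apply/existsP; exists r.
- have -> : 1 / 100 * N * #|M|%:R = \sum_(r in M) (1 / 100 * N).
    by rewrite sumr_const mulr_natr.
  rewrite (big_morph (fun a : R => 2 `^ a) (exp2D (R := R)) (powRr0 2)).
  pose W (r : 'I_n * 'I_n) := [set e in touch [set r.1] (triples V) | r.2 \in e].
  pose F' r := [set L in powerset (W r) | #|L|%:R <= alpha * N].
  apply: le_trans (_ : (\prod_(r in M) #|F' r|)%:R <= _).
    rewrite ler_nat; apply: (@card_cover_le _ _ _ _
        (fun r => [set e : {set 'I_n} | (r.1 \in e) && (r.2 \in e)])).
      move=> _ /imsetP[G GF ->]; apply/subsetP => e /setIP[_].
      rewrite inE => /existsP[r /andP[rM re]].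
      by apply/bigcupP; exists r; rewrite ?inE.
    move=> _ r /imsetP[G GF ->] rM.
    have [/cleanP[GV _ h] MG] := FP _ GF; rewrite -MG in rM; have {}h := h _ rM.
    rewrite in_set; apply/andP; split.
      rewrite inE; apply/subsetP => e /setIP[/setIP[eL _] eU].
      have [/(subsetP GV) eV _] := e2slot _ _ GF eL.
      have /andP[e1 e2] : (r.1 \in e) && (r.2 \in e) by move: eU; rewrite inE.
      by rewrite inE touch1E eV e1 e2.
    apply: le_trans h; rewrite ler_nat; apply/subset_leq_card/subsetP => e.
    move=> /setIP[/setIP[eL _] eU]; have [eG es] := e2slot _ _ GF eL.
    have re : (r.1 \in e) && (r.2 \in e) by move: eU; rewrite inE.
    by rewrite inE eG re andbT /=; move: es; rewrite inE => /andP[].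
  rewrite natr_prod; apply: ler_prod => r rM; rewrite ler0n /=.
  have [xX _ yX _] := pairP MXY rM.
  have xy : r.1 != r.2 by apply: contraNneq yX => <-.
  have c : #|W r|%:R <= N by rewrite ler_nat card_touch2_le.
  apply: le_trans (few_alpha c); rewrite ler_nat.
  by apply/subset_leq_card/subsetP => L; rewrite !inE.
- apply: powerset_exp; have sub : thinSlots X V M \subset slots X V.
    by apply/subsetP => e; rewrite inE => /andP[].
  by rewrite cardsDS // natrB ?subset_leq_card.
Qed.

(* For more than 20 thin pairs the bounds linear in #|M| suffice; for fewer the
   slots containing two thin pairs are negligible. *)
Lemma thin_gain (M : {set 'I_n * 'I_n}) :
  M \subset setX (X :&: V) (V :\: X) -> (1 < #|M|)%N ->
  #|forcedYY X V M|%:R + (1 / 100 * N * #|M|%:R + (S - #|thinSlots X V M|%:R))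
    <= S - 5 / 4 * N - 2 * lg R n * #|M|%:R.
Proof.
move=> MXY M2; have := card_forcedYY MXY; have := card_thinSlots_ge MXY.
have := card_thinSlots_ge_sparse MXY.
set f := #|forcedYY X V M|; set t := #|thinSlots X V M|; set j := #|M| => h1 h2 h3.
have p0 : (0 < #|X :&: V|)%N.
  by rewrite lt0n; apply: contraTneq p_ge => ->; rewrite -ltNge; move: n_large => ?; lra.
have pE : p - 1 = #|X :&: V|.-1%:R by rewrite -subn1 natrB.
have j2 : 2 <= j%:R :> R by rewrite (ler_nat _ 2).
have H1 : j%:R * (p - 1) <= t%:R + j%:R ^+ 2.
  by rewrite pE -natrM -natrX -natrD ler_nat.
have H2 : j%:R * (p - 1) <= 2 * t%:R by rewrite pE -!natrM ler_nat.
have H3 : 2 * f%:R <= j%:R * q.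
  rewrite -!natrM ler_nat; apply: leq_trans h3 _.
  by rewrite leq_mul2l geq_minl orbT.
have H4 : 2 * f%:R <= j%:R * j%:R :> R.
  rewrite -!natrM ler_nat; apply: leq_trans h3 _.
  by rewrite leq_mul2l geq_minr orbT.
move: p_ge q_le lg_small n_large => p1 q1 l1 n1.
have N0 : 0 <= N by lra.
have K1 : j%:R * (66 / 100 * N - 1) <= j%:R * (p - 1) by rewrite ler_wpM2l //; lra.
have K2 : j%:R * q <= j%:R * (335 / 1000 * N) by rewrite ler_wpM2l //; lra.
have K3 : lg R n * j%:R <= 1 / 1000 * N * j%:R by rewrite ler_wpM2r //; lra.
have K4 : 4000 * j%:R <= N * j%:R by rewrite ler_wpM2r //; lra.
have [j20|j21] := leqP j 20.
  have j20' : j%:R <= 20 :> R by rewrite (ler_nat _ _ 20).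
  have K5 : j%:R * j%:R <= 20 * j%:R :> R by rewrite ler_wpM2r //; lra.
  have K6 : 2 * N <= j%:R * N by rewrite ler_wpM2r.
  move: H1; rewrite expr2; lra.
have j21' : 21 <= j%:R :> R by rewrite (ler_nat _ 21).
have K6 : 21 * N <= j%:R * N by rewrite ler_wpM2r.
lra.
Qed.

Lemma expR1_le : expR 1 <= 2 `^ 2 :> R.
Proof.
have h : 1 / 2 <= ln 2 :> R.
  have : ln (1 + (- (1 / 2))) <= - (1 / 2) :> R by apply: le_ln1Dx; lra.
  have -> : 1 + (- (1 / 2)) = 2^-1 :> R by field.
  by rewrite lnV ?posrE // lerN2.
by rewrite /powR pnatr_eq0 /= ler_expR; lra.
Qed.

(** The term [2 * lg R n * #|M|] of [thin_gain] turns the sum over [M] into one with weights n^(- 2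
    |M|). As there are at most n^2 pairs, that sum is at most (1 + n^(-2))^(n^2) <= e <= 4, which
    fits into the gap n / 20 between 5/4 n and 6/5 n. *)
Lemma card_clean_inconsistent :
  #|[set G in clean | inconsistent G X != set0]|%:R <= 2 `^ (S - 6 / 5 * N).
Proof.
pose W := setX (X :&: V) (V :\: X).
(* One XYY-edge already contributes two pairs, so [M] never has exactly one element. *)
pose big (M : {set 'I_n * 'I_n}) := (M \subset W) && (1 < #|M|)%N.
pose F M := [set G in clean | thinPairs G == M].
have sub : [set G in clean | inconsistent G X != set0] \subset \bigcup_(M | big M) F M.
  apply/subsetP => G; rewrite in_set => /andP[Gc /set0Pn[e]].
  rewrite in_set => /andP[eG e2]; apply/bigcupP; exists (thinPairs G); last first.
    by rewrite in_set Gc eqxx.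
  have [/subsetP GV h _] := cleanP Gc.
  have e1 : #|e :&: X| = 1%N by case: (h _ eG) e2 => ->.
  have := GV _ eG; rewrite in_set => /andP[/subsetP eV /eqP e3].
  have sW : thinPairs G \subset W by apply/subsetP => r; rewrite in_set => /andP[].
  rewrite /big sW /=.
  have <- : #|setX (e :&: X) (e :\: X)| = 2%N by rewrite cardsX (card_setD_X _ e3) e1.
  apply/subset_leq_card/subsetP => -[x y]; rewrite in_setX !inE /=.
  move=> /andP[/andP[xe xX] /andP[yX ye]]; rewrite xX yX !eV //=.
  by apply/existsP; exists e; rewrite eG e1 xe ye.
apply: le_trans (_ : \sum_(M | big M) #|F M|%:R <= _).
  rewrite -natr_sum ler_nat; apply: leq_trans (subset_leq_card sub) _.
  exact: card_bigcup_sum.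
pose t : R := 2 `^ (- (2 * lg R n)).
apply: le_trans (_ : 2 `^ (S - 5 / 4 * N) *
    \sum_(M : {set 'I_n * 'I_n} | M \subset W) t ^+ #|M| <= _).
  rewrite mulr_sumr big_mkcond [leRHS]big_mkcond /=; apply: ler_sum => M _.
  rewrite /big; case: (boolP (M \subset W)) => //= MW.
  case: (ltnP 1 #|M|) => M2; last by rewrite mulr_ge0 ?exprn_ge0 ?exp2_ge0.
  apply: le_trans (card_thinPairs_fiber MW) _.
  rewrite exp2X -exp2D; apply: ler_exp2; apply: le_trans (thin_gain MW M2) _.
  by rewrite mulNr.
rewrite sum_subsets_expr.
have -> : S - 6 / 5 * N = (S - 5 / 4 * N) + 1 / 20 * N by field.
rewrite [leRHS]exp2D ler_wpM2l ?exp2_ge0 //.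
apply: le_trans (_ : 2 `^ 2 <= _); last by move: n_large => ?; apply: ler_exp2; lra.
apply: le_trans expR1_le; apply: le_trans (_ : expR (t *+ #|W|) <= _).
  rewrite -mulr_natl expRM_natl lerXn2r ?nnegrE ?expR_ge0 ?addr_ge0 ?exp2_ge0 //.
  exact: expR_ge1Dx.
rewrite ler_expR -mulr_natr.
have n0 : (0 < n)%N by rewrite -(@ltr0n R); move: n_large => ?; lra.
have -> : t = (N ^+ 2)^-1.
  by rewrite /t powRN mulrC -exp2X exp2_lg.
rewrite mulrC ler_pdivrMr ?exprn_gt0 ?ltr0n // mul1r -natrX ler_nat cardsX expnS expn1.
by rewrite leq_mul // -[leqRHS]card_ord max_card.
Qed.

Lemma card_clean : #|clean|%:R <= 2 `^ S + 2 `^ (S - 6 / 5 * N) :> R.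
Proof.
apply: le_trans (lerD (lexx _) card_clean_inconsistent).
rewrite -exp2_nat -card_powerset -natrD ler_nat.
apply: leq_trans (_ : #|powerset (slots X V) :|:
    [set G in clean | inconsistent G X != set0]| <= _)%N.
  apply/subset_leq_card/subsetP => G Gc; apply/setUP.
  have [e|ne] := eqVneq (inconsistent G X) set0; [left; rewrite inE|right]; last first.
    by rewrite in_set Gc.
  have [/subsetP GV _ _] := cleanP Gc; apply/subsetP => a aG.
  rewrite in_set GV //=; apply/negPn/negP => a2.
  have : a \in inconsistent G X by rewrite in_set aG.
  by rewrite e inE.
exact: leq_card_setU.
Qed.

End CleanCount.

(** * Structure of the traces *)

(** Every pair of [P] meets one of the 2|M| vertices of a maximum matching, and each vertex lies in
    at most n pairs. This turns a quadratic number of link pairs into the linear matchings that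
    lower density asks for. *)
Lemma big_matching n (P : {set {set 'I_n}}) :
  (forall r, r \in P -> #|r| = 2%N) ->
  exists M : {set {set 'I_n}},
    [/\ M \subset P, trivIset M & (#|P| <= 2 * #|M| * n)%N].
Proof.
move=> P2.
have h0 : (set0 \subset P) && trivIset (set0 : {set {set 'I_n}}).
  by rewrite sub0set; apply/trivIsetP => A B; rewrite inE.
case: (@arg_maxnP _ set0 (fun M : {set {set 'I_n}} => (M \subset P) && trivIset M)
         (fun M : {set {set 'I_n}} => #|M|) h0) => M /andP[MP triv] maxM.
exists M; split=> //.
apply: leq_trans (_ : #|cover M| * n <= _)%N; last first.
  rewrite leq_mul2r; apply/orP; right; apply: leq_trans (leq_card_cover M) _.
  rewrite (eq_bigr (fun=> 2%N)) ?sum_nat_const 1?mulnC //.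
  by move=> r /(subsetP MP); exact: P2.
have meet r : r \in P -> ~~ [disjoint r & cover M].
  move=> rP; apply/negP => dis.
  have rM : r \notin M.
    apply/negP => rM; have /eqP := P2 _ rP; rewrite (_ : r = set0) ?cards0 //.
    apply/eqP; rewrite -subset0 -(disjoint_setI0 dis) subsetIidl.
    exact: bigcup_sup.
  suff /maxM : (r |: M \subset P) && trivIset (r |: M).
    by rewrite /= cardsU1 rM add1n ltnn.
  rewrite subUset sub1set rP MP /=; apply/trivIsetP => A B.
  have sub C : C \in M -> [disjoint r & C].
    by move=> CM; apply: disjointWr dis; exact: bigcup_sup.
  rewrite !inE => /orP[/eqP->|AM] /orP[/eqP->|BM] AB.
  - by rewrite eqxx in AB.
  - exact: sub.
  - by rewrite disjoint_sym sub.
  - exact: (trivIsetP triv).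
apply: leq_trans (_ : #|\bigcup_(w in cover M) [set r in P | w \in r]| <= _)%N.
  apply/subset_leq_card/subsetP => r rP.
  have /pred0Pn[w /= /andP[wr wM]] := meet _ rP.
  by apply/bigcupP; exists w; rewrite ?inE ?rP.
apply: leq_trans (card_bigcup_sum _ _) _.
rewrite -sum_nat_const; apply: leq_sum => w _.
rewrite -[leqRHS]card_ord -cardsT.
apply: leq_trans (leq_imset_card (fun u => [set w; u]) _).
apply/subset_leq_card/subsetP => r; rewrite inE => /andP[rP wr].
have /eqP/cards2P[a [b [_ E]]] := P2 _ rP; move: wr; rewrite E !inE.
by case/orP => /eqP->; apply/imsetP; [exists b|exists a]; rewrite ?inE // setUC.
Qed.

(** The form in which T5-freeness is used throughout: the neighbourhood of a pair spans no edge. The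
    vertices a, b play the roles of 1, 2, and u, v, w those of 3, 4, 5. *)
Lemma T5_free_link n (H : hypergraph n) (a b u v w : 'I_n) :
  three_graph H -> ~ contains H T5 ->
  [set a; b; u] \in H -> [set a; b; v] \in H -> [set a; b; w] \in H ->
  [set u; v; w] \notin H.
Proof.
move=> H3 free hu hv hw; apply/negP => he; apply: free.
have dist x y z : [set x; y; z] \in H -> [&& x != y, x != z & y != z].
  move=> /H3; rewrite -setUA cardsU1 cards2 !inE.
  by case: (x == y); case: (x == z); case: (y == z).
have /and3P[ab au bu] := dist _ _ _ hu.
have /and3P[_ av bv] := dist _ _ _ hv.
have /and3P[_ aw bw] := dist _ _ _ hw.
have /and3P[uv uw vw] := dist _ _ _ he.
pose s := [:: a; b; u; v; w]; pose f (i : 'I_5) := nth a s i.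
have us : uniq s.
  by rewrite /= !inE !negb_or ab au av aw bu bv bw uv uw vw.
exists f.
  move=> i j /eqP; rewrite /f nth_uniq ?(ltn_ord i) ?(ltn_ord j) //.
  by move/eqP/val_inj.
move=> e; rewrite /T5 !inE => /orP[/orP[/orP[]|]|] /eqP->;
  by rewrite !imsetU !imset_set1 /f !inordK.
Qed.

Section Structure.
Variables (R : realType) (n : nat) (X V : {set 'I_n}) (alpha beta mu : R).
Variable H : hypergraph n.
Local Notation N := (@GRing.natmul R 1 n).
Local Notation G := (restr V H).
Implicit Types (u v w x y z a b : 'I_n) (e r A : {set 'I_n}).

Hypothesis H3 : three_graph H.
Hypothesis H_free : ~ contains H T5.
Hypothesis H_opt : optimal H X.
Hypothesis H_dense : lower_dense mu H X.
Hypothesis V_large : #|~: V|%:R <= mu * N.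

(* With G = restr V H, these are the triples behind L_{Y,Y}(v), L_{X,Y}(v) and
   L_{X,X}(v) for i = 0, 1, 2. *)
Definition linkType (F : hypergraph n) v i : {set {set 'I_n}} :=
  [set e in F | (v \in e) && (#|(e :\ v) :&: X| == i)].

Lemma restr_sub : G \subset triples V.
Proof.
by apply/subsetP => e; rewrite !inE => /andP[/H3-> ->].
Qed.

Lemma restrS e : e \in G -> e \in H.
Proof. by rewrite inE => /andP[]. Qed.

Lemma meetX_in v e : v \in X -> v \in e -> #|e :&: X| = #|(e :\ v) :&: X|.+1.
Proof.
by move=> vX ve; rewrite (cardsD1 v) inE ve vX add1n setIDAC.
Qed.

Lemma meetX_notin v e : v \notin X -> (e :\ v) :&: X = e :&: X.
Proof.
move=> vX; apply/setP => u; rewrite !inE.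
by case: eqVneq => [->|//]; rewrite (negbTE vX) !andbF.
Qed.

(** Moving v across the partition changes the status only of edges at v whose other two vertices
    include one or two of X; [c] counts all the others. Naming both positions of v makes the
    statement serve v in X and v in Y alike. *)
Lemma inconsistent_move v : exists c,
  #|inconsistent H (X :\ v)| = (#|linkType H v 1| + c)%N /\
  #|inconsistent H (v |: X)| = (#|linkType H v 2| + c)%N.
Proof.
exists #|[set e in H | if v \in e then (#|(e :\ v) :&: X| != 1%N) &&
   (#|(e :\ v) :&: X| != 2%N) else #|e :&: X| != 2%N]|; split.
  rewrite -(cardsID (linkType H v 1)); congr (_ + _)%N; apply: eq_card => e.
    rewrite !inE setIDA -setIDAC; case: (e \in H) => //=; case: (v \in e); rewrite ?andbF //=.
    by case: (_ =P 1%N) => [->|]; rewrite ?andbF.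
  rewrite !inE setIDA -setIDAC; case: (e \in H); rewrite ?andbF //=.
  case: ifP => [//|/negbT ve] /=.
  by rewrite (_ : e :\ v = e) //; apply/setDidPl; rewrite disjoint_sym disjoints1.
have vin e : v \in e -> #|e :&: (v |: X)| = #|(e :\ v) :&: X|.+1.
  move=> ve; rewrite (cardsD1 v) !inE ve eqxx add1n; congr _.+1.
  by apply: eq_card => u; rewrite !inE; case: (u == v); rewrite ?andbF.
rewrite -(cardsID (linkType H v 2)); congr (_ + _)%N; apply: eq_card => e.
  rewrite !inE; case: (e \in H) => //=; have [ve|] := boolP (v \in e); rewrite ?andbF //=.
  by rewrite vin //; case: (#|(e :\ v) :&: X| =P 2%N) => [->|]; rewrite ?andbF.
rewrite !inE; case: (e \in H); rewrite ?andbF //=.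
case: ifP => [ve|/negbT ve] /=; first by rewrite vin // eqSS andbC.
rewrite setIUr (_ : e :&: [set v] = set0) ?set0U //.
by apply/disjoint_setI0; rewrite disjoint_sym disjoints1.
Qed.

Lemma optimal_deg_in x : x \in X ->
  (#|linkType H x 2| <= #|linkType H x 1|)%N.
Proof.
move=> xX; have [c [c1 c2]] := inconsistent_move x.
rewrite -(leq_add2r c) -c1 -c2 (_ : x |: X = X); first exact: H_opt.
by apply/setUidPr; rewrite sub1set.
Qed.

Lemma optimal_deg_out y : y \notin X ->
  (#|linkType H y 1| <= #|linkType H y 2|)%N.
Proof.
move=> yX; have [c [c1 c2]] := inconsistent_move y.
rewrite -(leq_add2r c) -c1 -c2 (_ : X :\ y = X).
  exact: H_opt.
by apply/setDidPl; rewrite disjoint_sym disjoints1.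
Qed.

(** Optimality speaks of H, the counts speak of its trace. An edge at v lost in the trace contains
    some w outside V, and the pair vw lies in at most n triples. *)
Lemma linkType_restr v i : v \in V ->
  (#|linkType G v i| <= #|linkType H v i|)%N /\
  #|linkType H v i|%:R <= #|linkType G v i|%:R + mu * N ^+ 2.
Proof.
move=> vV; split.
  by apply/subset_leq_card/subsetP => e; rewrite !inE => /andP[/andP[-> _]].
pose B := \bigcup_(w in ~: V) [set e in touch [set v] (triples [set: 'I_n]) | w \in e].
apply: le_trans (_ : #|linkType G v i|%:R + #|B|%:R <= _).
  rewrite -natrD ler_nat; apply: leq_trans (leq_card_setU _ _).
  apply/subset_leq_card/subsetP => e; rewrite in_set => /andP[eH he].
  apply/setUP; have [eV|eV] := boolP (e \subset V); [left|right].
    by rewrite in_set he inE eH eV.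
  have /subsetPn[w we wV] := eV; apply/bigcupP; exists w; first by rewrite inE.
  rewrite in_set touch1E we andbT inE subsetT (H3 eH) eqxx /=.
  by move: he => /andP[].
rewrite lerD2l expr2 mulrA.
apply: le_trans (card_bigcup_le (b := N) _) _.
  move=> w; rewrite inE => wV; rewrite ler_nat card_touch2_le //.
  by apply: contraNneq wV => <-.
by rewrite ler_wpM2r.
Qed.

Lemma linkType_pairs (C : {set 'I_n}) v i :
  (forall e, e \in linkType G v i -> e :\ v \subset C) ->
  (#|linkType G v i| <= #|[set r in pairs_in C | v |: r \in H]|)%N.
Proof.
move=> hC.
apply: leq_trans (leq_imset_card (fun r => v |: r) _).
apply/subset_leq_card/subsetP => e eL; have := hC _ eL.
move: eL; rewrite !in_set => /andP[/andP[eH _] /andP[ve _]] sub.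
apply/imsetP; exists (e :\ v); last by rewrite setD1K.
rewrite inE inE sub setD1K // eH andbT /=.
by have := H3 eH; rewrite (cardsD1 v) ve add1n => -[->].
Qed.

Lemma linkType1_pairs v :
  (#|linkType G v 1| <=
   #|[set r in setX X (~: X) | [set v; r.1; r.2] \in H]|)%N.
Proof.
apply: leq_trans (leq_imset_card (fun r : 'I_n * 'I_n => [set v; r.1; r.2]) _).
apply/subset_leq_card/subsetP => e; rewrite in_set => /andP[eG /andP[ve e1]].
have [a [b [[ab E E'] _]]] := triple_at (subsetP restr_sub _ eG) ve.
have eH := restrS eG.
have key c d : c \in X -> d \notin X -> e = [set v; c; d] ->
    e \in [set [set v; r.1; r.2] | r in [set r in setX X (~: X) | [set v; r.1; r.2] \in H]].
  move=> cX dX Ecd; apply/imsetP; exists (c, d); last exact: Ecd.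
  by rewrite in_set in_setX /= cX in_setC dX -Ecd eH.
move: e1; rewrite E' setIUl.
have [aX|aX] := boolP (a \in X); have [bX|bX] := boolP (b \in X).
- by rewrite !(setIidPl _) ?sub1set // cards2 ab.
- by move=> _; exact: key E.
- by move=> _; apply: (key b a) => //; rewrite E setUAC.
- by rewrite !disjoint_setI0 ?disjoints1 // setU0 cards0.
Qed.

Lemma dense_matching (P : {set {set 'I_n}}) :
  (forall r, r \in P -> #|r| = 2%N) -> 2 * mu * N ^+ 2 < #|P|%:R ->
  exists M : {set {set 'I_n}}, [/\ M \subset P, trivIset M & mu * N < #|M|%:R].
Proof.
move=> P2 big; have [M [MP triv le]] := big_matching P2.
exists M; split=> //; rewrite ltNge; apply/negP => Mle.
have : #|P|%:R <= 2 * (mu * N) * N.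
  apply: le_trans (_ : (2 * #|M| * n)%:R <= _); first by rewrite ler_nat.
  by rewrite !natrM ler_wpM2r // ler_wpM2l.
by rewrite leNgt => /negP[]; move: big; rewrite expr2 !mulrA.
Qed.

Lemma pairs_in2 (C : {set 'I_n}) r : r \in pairs_in C -> #|r| = 2%N.
Proof. by rewrite inE => /andP[_ /eqP]. Qed.

(* Density (i) yields ab in L_{X,Y}(v) and uw in L_{X,X}(v) such that ab has the
   neighbours v, u, w, which span the edge vuw: a copy of T5. *)
Lemma few_XX_XY v : mu * N ^+ 2 < #|linkType G v 1|%:R ->
  #|linkType G v 2|%:R <= 2 * mu * N ^+ 2.
Proof.
move=> big1; rewrite leNgt; apply/negP => big2.
pose P := [set r in pairs_in X | v |: r \in H].
pose Q := [set r in setX X (~: X) | [set v; r.1; r.2] \in H].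
have PX : P \subset pairs_in X by apply/subsetP => r; rewrite inE => /andP[].
have QX : Q \subset setX X (~: X) by apply/subsetP => r; rewrite inE => /andP[].
have cP : 2 * mu * N ^+ 2 < #|P|%:R.
  apply: lt_le_trans big2 _; rewrite ler_nat; apply: linkType_pairs => e.
  rewrite inE => /andP[eG /andP[ve /eqP e2]].
  have := restr_sub; move=> /subsetP/(_ _ eG); rewrite inE => /andP[_].
  rewrite (cardsD1 v) ve add1n eqSS => e2'.
  by apply/setIidPl/eqP; rewrite eqEcard subsetIl e2 (eqP e2').
have cQ : mu * N ^+ 2 < #|Q|%:R.
  by apply: lt_le_trans big1 _; rewrite ler_nat linkType1_pairs.
have [M [MP triv Mbig]] :=
  dense_matching (fun r rP => pairs_in2 (subsetP PX r rP)) cP.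
have [h _ _ _ _] := H_dense.
have := h M Q (subset_trans MP PX) triv QX Mbig cQ.
(* Only positivity of the lower bound matters here: a single pair of witnesses completes the T5. *)
move=> /(le_lt_trans (_ : 0 <= _)); rewrite ltr0n card_gt0 => /(_ _)/set0Pn[|].
  by rewrite divr_ge0 ?mulr_ge0.
move=> [[a b] r]; rewrite in_set => /and3P[/= abQ rM /forallP hr].
have /(subsetP MP) := rM; rewrite inE => /andP[rX vr].
have /eqP/cards2P[u [w [_ E]]] := pairs_in2 rX.
move: abQ; rewrite in_set => /andP[_ /= abv].
have hu : [set a; b; u] \in H by have := hr u; rewrite E !inE eqxx.
have hw : [set a; b; w] \in H by have := hr w; rewrite E !inE eqxx orbT.
have hv : [set a; b; v] \in H by rewrite setUC setUA.
have := T5_free_link H3 H_free hv hu hw.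
by rewrite -setUA -E vr.
Qed.

(* Density (ii) yields uw in L_{X,X}(v) and ab in L_{Y,Y}(v) such that uw has the
   neighbours v, a, b, which span the edge vab. *)
Lemma few_XX_YY v : 2 * mu * N ^+ 2 < #|linkType G v 0|%:R ->
  #|linkType G v 2|%:R <= mu * N ^+ 2.
Proof.
move=> big0; rewrite leNgt; apply/negP => big2.
pose P := [set r in pairs_in X | v |: r \in H].
pose Q := [set r in pairs_in (~: X) | v |: r \in H].
have PX : P \subset pairs_in X by apply/subsetP => r; rewrite inE => /andP[].
have QX : Q \subset pairs_in (~: X) by apply/subsetP => r; rewrite inE => /andP[].
have cP : mu * N ^+ 2 < #|P|%:R.
  apply: lt_le_trans big2 _; rewrite ler_nat; apply: linkType_pairs => e.
  rewrite inE => /andP[eG /andP[ve /eqP e2]].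
  have := restr_sub; move=> /subsetP/(_ _ eG); rewrite inE => /andP[_].
  rewrite (cardsD1 v) ve add1n eqSS => e2'.
  by apply/setIidPl/eqP; rewrite eqEcard subsetIl e2 (eqP e2').
have cQ : 2 * mu * N ^+ 2 < #|Q|%:R.
  apply: lt_le_trans big0 _; rewrite ler_nat; apply: linkType_pairs => e.
  rewrite inE => /andP[eG /andP[ve e0]].
  by rewrite -disjoints_subset -setI_eq0 -cards_eq0.
have [M [MQ triv Mbig]] :=
  dense_matching (fun r rQ => pairs_in2 (subsetP QX r rQ)) cQ.
have [_ h _ _ _] := H_dense.
have := h P M PX (subset_trans MQ QX) triv cP Mbig.
move=> /(le_lt_trans (_ : 0 <= _)); rewrite ltr0n card_gt0 => /(_ _)/set0Pn[|].
  by rewrite divr_ge0 ?mulr_ge0.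
move=> [s r]; rewrite in_set => /and3P[/= sM rP /forallP hs].
have /(subsetP MQ) := sM; rewrite in_set => /andP[sX vs].
have /eqP/cards2P[a [b [_ E]]] := pairs_in2 sX.
move: rP; rewrite in_set => /andP[rX vr].
have /eqP/cards2P[u [w [_ E']]] := pairs_in2 rX.
have link c : c |: r \in H -> [set u; w; c] \in H by rewrite E' setUC.
have ha : [set u; w; a] \in H by apply: link; have := hs a; rewrite E !inE eqxx.
have hb : [set u; w; b] \in H by apply: link; have := hs b; rewrite E !inE eqxx orbT.
have := T5_free_link H3 H_free (link _ vr) ha hb.
by rewrite -setUA -E vs.
Qed.

(** By optimality x has at least as many XY-edges as XX-edges, so many XX-edges would contradict
    [few_XX_XY]. *)
Lemma linkX_XX x : x \in X -> x \in V -> #|linkType G x 2|%:R <= 2 * mu * N ^+ 2.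
Proof.
move=> xX xV; rewrite leNgt; apply/negP => big2.
suff /few_XX_XY : mu * N ^+ 2 < #|linkType G x 1|%:R by rewrite leNgt big2.
have [_ h1] := linkType_restr 1 xV; have [h2 _] := linkType_restr 2 xV.
have h : (#|linkType G x 2| <= #|linkType H x 1|)%N.
  exact: leq_trans h2 (optimal_deg_in xX).
have {}h : #|linkType G x 2|%:R <= #|linkType H x 1|%:R :> R by rewrite ler_nat.
lra.
Qed.

(** By optimality y has at least as many XX-edges as XY-edges, and [few_XX_XY] excludes that both
    are many. The constant 3 is the 2 of that lemma plus 1 for the edges lost outside V. *)
Lemma linkY_XY y : y \notin X -> y \in V -> #|linkType G y 1|%:R <= 3 * mu * N ^+ 2.
Proof.
move=> yX yV; rewrite leNgt; apply/negP => big1.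
have [h1 _] := linkType_restr 1 yV; have [_ h2] := linkType_restr 2 yV.
have h : (#|linkType G y 1| <= #|linkType H y 2|)%N.
  exact: leq_trans h1 (optimal_deg_out yX).
have {}h : #|linkType G y 1|%:R <= #|linkType H y 2|%:R :> R by rewrite ler_nat.
have h3 : 0 <= mu * N ^+ 2.
  have : 0 <= mu * N by apply: le_trans V_large.
  by move=> h0; rewrite expr2 mulrA mulr_ge0.
suff : mu * N ^+ 2 < #|linkType G y 1|%:R by move/few_XX_XY; lra.
lra.
Qed.

(** The families classify edges by their trace on X, the links by the other two vertices; the
    boolean accounts for v itself when it lies in X. *)
Lemma linkType_touch v k : v \in V ->
  [set e in touch [set v] G | #|e :&: X| == k + (v \in X)]%N = linkType G v k.
Proof.
move=> vV; apply/setP => e; rewrite in_set touch1E [RHS]in_set -andbA.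
case: (e \in G) => //=; have [ve|] //= := boolP (v \in e).
have [vX|vX] := boolP (v \in X); first by rewrite (meetX_in vX ve) addn1 eqSS.
by rewrite meetX_notin // addn0.
Qed.

Definition sparse_at z : bool :=
  [exists A : {set 'I_n}, [&& A \subset X :&: V, alpha * N <= #|A|%:R
        & [forall e in touch [set z] G, ~~ (e :\ z \subset A)]]].

(* The codegree set A of xy in X contains no pair of the link of z when xyz is an
   edge, by T5-freeness at the pair xy. *)
Lemma codeg_thin x y e :
  (forall z, z \in V :\: X -> ~~ sparse_at z) ->
  x \in X -> y \notin X -> e \in G -> #|e :&: X| = 1%N -> x \in e -> y \in e ->
  #|[set e in G | [&& #|e :&: X| == 2%N, x \in e & y \in e]]|%:R <= alpha * N.
Proof.
move=> nosparse xX yX eG e1 xe ye; rewrite leNgt; apply/negP => big.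
have xy : x != y by apply: contraNneq yX => <-.
have [eV e3] : e \subset V /\ #|e| = 3%N.
  by have := subsetP restr_sub _ eG; rewrite inE => /andP[-> /eqP].
have : (0 < #|e :\: X :\ y|)%N.
  have := card_setD_X X e3; rewrite e1 (cardsD1 y) in_setD yX ye add1n => -[->].
  by [].
rewrite card_gt0 => /set0Pn[z]; rewrite !inE => /and3P[zy zX ze].
have xz : x != z by apply: contraNneq zX => <-.
have E : e = [set x; y; z].
  apply/esym/eqP; rewrite eqEcard e3; apply/andP; split.
    by apply/subsetP => u; rewrite !inE => /orP[/orP[]|] /eqP->.
  by rewrite -setUA cardsU1 cards2 !inE (negbTE xy) (negbTE xz) eq_sym zy.
pose A := [set u in X :&: V | [set x; y; u] \in G].
have zV : z \in V :\: X by rewrite inE zX (subsetP eV).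
have /negP[] := nosparse z zV; apply/existsP; exists A; apply/and3P; split.
- by apply/subsetP => u; rewrite inE => /andP[].
- apply: le_trans (ltW big) _; rewrite ler_nat.
  apply: leq_trans (leq_imset_card (fun u => [set x; y; u]) _).
  apply/subset_leq_card/subsetP => f; rewrite in_set => /and4P[fG /eqP f2 xf yf].
  have [fV f3] : f \subset V /\ #|f| = 3%N.
    by have := subsetP restr_sub _ fG; rewrite inE => /andP[-> /eqP].
  have : (0 < #|(f :&: X) :\ x|)%N.
    by move: f2; rewrite (cardsD1 x) inE xf xX add1n => -[->].
  rewrite card_gt0 => /set0Pn[u]; rewrite !inE => /and3P[ux uf uX].
  have uy : y != u by apply: contraNneq yX => ->.
  have F : [set x; y; u] = f.
    apply/eqP; rewrite eqEcard f3; apply/andP; split.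
      by apply/subsetP => w; rewrite !inE => /orP[/orP[]|] /eqP->.
    by rewrite -setUA cardsU1 cards2 !inE (negbTE xy) [x == u]eq_sym (negbTE ux) uy.
  by apply/imsetP; exists u; rewrite // in_set F fG inE uX (subsetP fV).
apply/forallP => f; apply/implyP; rewrite touch1E => /andP[fG zf].
apply/negP => /subsetP fA.
have [u [w [[_ F F'] _]]] := triple_at (subsetP restr_sub _ fG) zf.
have uA : u \in A by apply: fA; rewrite F' !inE eqxx.
have wA : w \in A by apply: fA; rewrite F' !inE eqxx orbT.
move: uA wA; rewrite !in_set => /andP[_ /andP[uH _]] /andP[_ /andP[wH _]].
have zH : [set x; y; z] \in H by rewrite -E restrS.
by have := T5_free_link H3 H_free zH uH wH; rewrite -F restrS.
Qed.

Hypothesis mu_beta : 5 * mu <= beta.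
Hypothesis mu0 : 0 <= mu.

(** The order of the cases matters. Without heavy vertices of Y, every vertex of Y has few
    inconsistent edges, as [sparseY] requires. Without sparse vertices, [codeg_thin] supplies the
    codegree bound in [heavyX]. Without heavy vertices of X, every vertex has few inconsistent
    edges, as [monoEdge] requires. Without an edge inside X or inside Y, the trace is clean. *)
Lemma clean_or_reducible :
  [\/ G \in clean X V alpha,
      exists2 y, y \in V :\: X & touch [set y] G \in heavyY X V mu y :|: sparseY X V alpha mu y,
      exists2 x, x \in X :&: V & touch [set x] G \in heavyX X V alpha beta mu x |
      exists2 T, (T \in triples V) && ((T \subset X) || [disjoint T & X]) &
        touch T G \in monoEdge X V beta T].
Proof.
have touchG T : touch T G \subset touch T (triples V).
  by apply/subsetP => e; rewrite !in_set => /andP[/andP[/H3-> ->] ->].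
have muN : 0 <= mu * N ^+ 2 by rewrite mulr_ge0 // sqr_ge0.
have [/existsP[y /andP[yV big0]]|/existsPn noY] :=
    boolP [exists y, (y \in V :\: X) && (2 * mu * N ^+ 2 < #|linkType G y 0|%:R)].
  have [yX yV'] : y \notin X /\ y \in V by move: yV; rewrite inE => /andP.
  apply: Or42; exists y => //; rewrite in_setU; apply/orP; left.
  rewrite in_set touchG /=.
  apply: le_trans (_ : #|linkType G y 1|%:R + #|linkType G y 2|%:R <= _).
    rewrite -natrD ler_nat; apply: leq_trans (leq_card_setU _ _).
    apply/subset_leq_card/subsetP => e; rewrite in_set => /andP[eT].
    rewrite -card_gt0 => e0; rewrite -!linkType_touch // (negbTE yX) !addn0.
    have := subsetP (touchG _) _ eT; rewrite touch1E => /andP[].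
    rewrite inE => /andP[_ /eqP e3] ye.
    have : (#|e :&: X| <= 2)%N.
      rewrite -ltnS -e3; apply: proper_card; rewrite properE subsetIl /=.
      by apply/subsetPn; exists y; rewrite // inE (negbTE yX) andbF.
    have mem i : (e \in [set e in touch [set y] G | #|e :&: X| == i]) = (#|e :&: X| == i).
      by rewrite in_set eT.
    by rewrite in_setU !mem; case: #|_| e0 => [|[|[|]]].
  have := linkY_XY yX yV'; have := few_XX_YY big0; lra.
have smallY y : y \in V :\: X -> #|linkType G y 0|%:R <= 2 * mu * N ^+ 2.
  by move=> yV; have := noY y; rewrite yV /= -leNgt.
have smallY' y : y \in V :\: X ->
    #|[set e in touch [set y] G | #|e :&: X| != 2%N]|%:R <= 5 * mu * N ^+ 2.
  move=> yV; have [yX yV'] : y \notin X /\ y \in V by move: yV; rewrite inE => /andP.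
  apply: le_trans (_ : #|linkType G y 0|%:R + #|linkType G y 1|%:R <= _).
    rewrite -natrD ler_nat; apply: leq_trans (leq_card_setU _ _).
    apply/subset_leq_card/subsetP => e; rewrite in_set => /andP[eT].
    move=> e0; rewrite -!linkType_touch // (negbTE yX) !addn0.
    have := subsetP (touchG _) _ eT; rewrite touch1E => /andP[].
    rewrite inE => /andP[_ /eqP e3] ye.
    have : (#|e :&: X| <= 2)%N.
      rewrite -ltnS -e3; apply: proper_card; rewrite properE subsetIl /=.
      by apply/subsetPn; exists y; rewrite // inE (negbTE yX) andbF.
    have mem i : (e \in [set e in touch [set y] G | #|e :&: X| == i]) = (#|e :&: X| == i).
      by rewrite in_set eT.
    by rewrite in_setU !mem; case: #|_| e0 => [|[|[|]]].
  have := linkY_XY yX yV'; have := smallY _ yV; lra.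
have [/existsP[z /andP[zV sz]]|/existsPn noS] :=
    boolP [exists z, (z \in V :\: X) && sparse_at z].
  apply: Or42; exists z => //; rewrite in_setU; apply/orP; right.
  by rewrite in_set touchG smallY'.
have nosparse z : z \in V :\: X -> ~~ sparse_at z.
  by move=> zV; have := noS z; rewrite zV.
have [/existsP[x /andP[xXV big0]]|/existsPn noX] :=
    boolP [exists x, (x \in X :&: V) && (beta * N ^+ 2 <= #|linkType G x 0|%:R)].
  have [xX xV] : x \in X /\ x \in V by move: xXV; rewrite inE => /andP.
  apply: Or43; exists x => //; rewrite in_set touchG /=; apply/and3P; split.
  - rewrite (_ : [set e in _ | _] = linkType G x 2).
      have := linkX_XX xX xV; lra.
    by rewrite -linkType_touch // xX.
  - by rewrite (_ : [set e in _ | _] = linkType G x 0) // -linkType_touch // xX.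
  apply/forallP => y; apply/implyP; rewrite inE => /andP[yX yV]; apply/implyP.
  move=> /existsP[e /andP[+ /andP[/eqP e1 ye]]]; rewrite touch1E => /andP[eG xe].
  apply: le_trans (codeg_thin nosparse xX yX eG e1 xe ye).
  rewrite ler_nat; apply/subset_leq_card/subsetP => f.
  rewrite in_set touch1E => /andP[/andP[fG xf] /andP[f2 yf]].
  by rewrite in_set fG f2 xf yf.
have smallX x : x \in X :&: V ->
    #|[set e in touch [set x] G | #|e :&: X| != 2%N]|%:R <= 6 * beta * N ^+ 2.
  move=> xXV; have [xX xV] : x \in X /\ x \in V by move: xXV; rewrite inE => /andP.
  apply: le_trans (_ : #|linkType G x 0|%:R + #|linkType G x 2|%:R <= _).
    rewrite -natrD ler_nat; apply: leq_trans (leq_card_setU _ _).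
    apply/subset_leq_card/subsetP => e; rewrite in_set => /andP[eT].
    move=> e0; rewrite -!linkType_touch // xX !addn1.
    have := subsetP (touchG _) _ eT; rewrite touch1E => /andP[].
    rewrite inE => /andP[_ /eqP e3] xe.
    have : (#|e :&: X| <= 3)%N by rewrite -e3 subset_leq_card // subsetIl.
    have : (0 < #|e :&: X|)%N by rewrite card_gt0; apply/set0Pn; exists x; rewrite inE xe.
    have mem i : (e \in [set e in touch [set x] G | #|e :&: X| == i]) = (#|e :&: X| == i).
      by rewrite in_set eT.
    by rewrite in_setU !mem; case: #|_| e0 => [|[|[|[|]]]].
  have hb : 5 * mu * N ^+ 2 <= beta * N ^+ 2 by rewrite ler_wpM2r // sqr_ge0.
  have := linkX_XX xX xV; have := noX x; rewrite xXV /= -ltNge; lra.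
have [/existsP[T /andP[TG mono]]|/existsPn noT] :=
    boolP [exists T, (T \in G) && ((T \subset X) || [disjoint T & X])].
  have TV := subsetP restr_sub _ TG.
  apply: Or44; exists T; first by rewrite TV.
  rewrite in_set touchG /=; apply/andP; split.
    have -> : 18 * beta * N ^+ 2 = #|T|%:R * (6 * beta * N ^+ 2).
      by move: TV; rewrite inE => /andP[_ /eqP->]; ring.
    apply: le_trans (card_bigcup_le
      (S := fun t => [set e in touch [set t] G | #|e :&: X| != 2%N]) _).
      rewrite ler_nat; apply/subset_leq_card/subsetP => e; rewrite in_set => /andP[eT e2].
      move: eT; rewrite in_set => /andP[eG /pred0Pn[t /= /andP[te tT]]].
      by apply/bigcupP; exists t; rewrite // in_set touch1E eG te.
    move=> t tT; have tV : t \in V.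
      by move: TV; rewrite inE => /andP[/subsetP h _]; exact: h.
    have hb : 5 * mu * N ^+ 2 <= beta * N ^+ 2 by rewrite ler_wpM2r // sqr_ge0.
    have [tX|tX] := boolP (t \in X); first by apply: smallX; rewrite inE tX.
    have := smallY' t; rewrite inE tX tV => /(_ isT); lra.
  (* A pair uw joined to every vertex of T would have the edge T inside its neighbourhood. *)
  apply/forallP => r; apply/implyP => /pairs_in2/eqP/cards2P[u [w [_ ->]]].
  apply/negP => /forallP h.
  have [a [b [c E]]] : exists a b c, T = [set a; b; c].
    have [t tT] : exists t, t \in T.
      by apply/set0Pn; rewrite -card_gt0; move: TV; rewrite inE => /andP[_ /eqP->].
    by have [a [b [[_ E _] _]]] := triple_at TV tT; exists t, a, b.
  have hh t : t \in T -> [set u; w; t] \in H.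
    move=> tT; have := h t; rewrite tT /= setUC => tG.
    by move: tG; rewrite in_set => /andP[/restrS].
  have ha : [set u; w; a] \in H by apply: hh; rewrite E !inE eqxx.
  have hb : [set u; w; b] \in H by apply: hh; rewrite E !inE eqxx orbT.
  have hc : [set u; w; c] \in H by apply: hh; rewrite E !inE eqxx orbT.
  by have := T5_free_link H3 H_free ha hb hc; rewrite -E restrS.
apply: Or41; rewrite in_set restr_sub /=; apply/andP; split.
  apply/forallP => e; apply/implyP => eG; have := noT e; rewrite eG /= negb_or.
  have := subsetP restr_sub _ eG; rewrite inE => /andP[_ /eqP e3] /andP[eX edX].
  have e0 : (0 < #|e :&: X|)%N by rewrite card_gt0 setI_eq0.
  have : (#|e :&: X| < 3)%N.
    by rewrite -e3; apply: proper_card; rewrite properE subsetIl subsetI subxx.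
  by case: #|_| e0 => [|[|[|]]].
apply/forallP => x; apply/implyP; rewrite inE => /andP[xX xV].
apply/forallP => y; apply/implyP; rewrite inE => /andP[yX yV]; apply/implyP.
move=> /existsP[e /andP[eG /and3P[/eqP e1 xe ye]]].
exact: codeg_thin nosparse xX yX eG e1 xe ye.
Qed.

End Structure.

(** * Recursion on traces *)

Lemma card_triples_le n (V : {set 'I_n}) : (#|triples V| <= n ^ 3)%N.
Proof.
apply: leq_trans (_ : #|touch [set: 'I_n] (triples V)| <= _)%N.
  apply/subset_leq_card/subsetP => e eV; rewrite inE eV -setI_eq0 setIT /=.
  move: eV; rewrite inE => /andP[_ e3].
  by apply: contraTneq e3 => ->; rewrite cards0.
by apply: leq_trans (card_touch_le _ _) _; rewrite cardsT card_ord -expnS.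
Qed.

Section Recursion.
Variables (R : realType) (n : nat) (X : {set 'I_n}) (alpha beta mu eta eps : R).
Local Notation N := (@GRing.natmul R 1 n).
Implicit Types (V T : {set 'I_n}) (H G : {set {set 'I_n}}).

(** X is fixed, and H keeps all n vertices, so optimality and density stay available at every stage
    of the recursion. *)
Definition nearOpt : {set {set {set 'I_n}}} :=
  [set H : {set {set 'I_n}} | `[< [/\ three_graph H, ~ contains H T5, optimal H X,
     lower_dense mu H X & #|inconsistent H X|%:R <= eta * N ^+ 3] >]].

Definition traces V : {set {set {set 'I_n}}} := [set restr V H | H in nearOpt].

Local Notation S V := (@GRing.natmul R 1 #|slots X V|).

Hypothesis few_mu : few_small (beta / 20) (5 * mu).
Hypothesis few_alpha : few_small (1 / 100) alpha.
Hypothesis few_beta : few_small (1 / 300) (6 * beta).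
Hypothesis few_eta : few_small eps eta.
Hypothesis alpha01 : 0 < alpha <= 1.
Hypothesis beta0 : 0 < beta.
Hypothesis beta_le : beta <= 1 / 25.
Hypothesis beta_alpha : beta <= alpha ^+ 2.
Hypothesis mu0 : 0 < mu.
Hypothesis mu_le : mu <= 1 / 1000.
Hypothesis mu_beta : 5 * mu <= beta.
Hypothesis eps_le : eps <= beta * mu / 32.
Hypothesis N_beta : 1000 <= beta * N.
Hypothesis N_mu : 36 <= mu * N.
Hypothesis lg_small : lg R n <= 1 / 1000 * N.

Lemma nearOptP H : H \in nearOpt -> [/\ three_graph H, ~ contains H T5, optimal H X,
     lower_dense mu H X & #|inconsistent H X|%:R <= eta * N ^+ 3].
Proof. by rewrite inE => /asboolP. Qed.

Lemma N_large : 4000 <= N.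
Proof.
have h : beta * N <= 1 / 25 * N by rewrite ler_wpM2r.
by move: N_beta h => h0 h; lra.
Qed.

(** |Y| is within n / 1000 of n / 3 and V misses at most n / 1000 vertices. An H is needed because
    the sizes come from its lower density. *)
Lemma part_sizes H V : H \in nearOpt -> #|~: V|%:R <= mu * N ->
  [/\ 66 / 100 * N <= #|X :&: V|%:R, 33 / 100 * N <= #|V :\: X|%:R &
      #|V :\: X|%:R <= 335 / 1000 * N].
Proof.
case/nearOptP => _ _ _ [_ _ _ _ hY] _ hV.
have h1 : mu * N <= 1 / 1000 * N by rewrite ler_wpM2r.
have cX : (#|X| <= #|X :&: V| + #|~: V|)%N.
  rewrite -(cardsID V X) leq_add2l; apply/subset_leq_card/subsetP => u.
  by rewrite !inE => /andP[].
have cY : (#|~: X| <= #|V :\: X| + #|~: V|)%N.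
  rewrite -(cardsID V (~: X)); apply: leq_add; apply/subset_leq_card/subsetP => u.
    by rewrite !inE.
  by rewrite !inE => /andP[].
have cY' : (#|V :\: X| <= #|~: X|)%N.
  by apply/subset_leq_card/subsetP => u; rewrite !inE => /andP[].
have cXY : #|X|%:R + #|~: X|%:R = N by rewrite -natrD cardsC card_ord.
move: cX cY cY'; rewrite -!(ler_nat R) !natrD => cX cY cY'.
move: hY; rewrite ltr_norml => /andP[hY1 hY2].
by split; lra.
Qed.

(** A trace on V is determined by its edges meeting T and its restriction to V minus T, and the
    latter is a trace of the same H. The factor [b] stands for whatever the recursion has achieved
    so far. *)
Lemma card_trace_fiber V T (F : {set {set {set 'I_n}}}) (b : R) : T \subset V ->
  #|F|%:R <= 2 `^ (#|touch T (slots X V)|%:R - beta / 4 * N ^+ 2) ->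
  #|traces (V :\: T)|%:R <= 2 `^ (S (V :\: T)) * b ->
  #|[set G in traces V | touch T G \in F]|%:R <=
    2 `^ (S V - beta / 4 * N ^+ 2) * b.
Proof.
move=> TV cF cT; set B := [set G in _ | _].
apply: le_trans (_ : (#|F| * #|traces (V :\: T)|)%:R <= _).
  rewrite ler_nat -cardsX.
  rewrite -(card_in_imset (f := fun G => (touch T G, restr (V :\: T) G)) (D := mem B)).
    apply/subset_leq_card/subsetP => _ /imsetP[G + ->].
    rewrite in_set => /andP[/imsetP[H HF ->] hT]; rewrite in_setX /= hT /=.
    apply/imsetP; exists H => //; apply/setP => e; rewrite !inE -andbA.
    by congr (_ && _); rewrite andb_idl // => /subset_trans; apply; exact: subsetDl.
  have sub G : G \in B -> G \subset triples V.
    rewrite in_set => /andP[/imsetP[H /nearOptP[H3 _ _ _ _] ->] _].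
    exact: restr_sub.
  move=> G G' /sub GV /sub G'V [e1 e2].
  by rewrite (touch_restr GV TV) e1 e2 -touch_restr.
rewrite natrM; apply: le_trans (ler_pM (ler0n _ _) (ler0n _ _) cF cT) _.
rewrite mulrA -exp2D (card_slots_split X TV) natrD.
by rewrite le_eqVlt; apply/orP; left; apply/eqP; congr (2 `^ _ * _); ring.
Qed.

(** The factor [4 * N ^+ 3] is the union bound: four kinds of families with at most n^3 sets T
    each. *)
Lemma card_dirty_traces V (b : R) : #|~: V|%:R <= mu * N -> 0 <= b ->
  (forall T, T \subset V -> (#|T| <= 3)%N ->
     #|traces (V :\: T)|%:R <= 2 `^ (S (V :\: T)) * b) ->
  #|traces V :\: clean X V alpha|%:R <=
    4 * N ^+ 3 * (2 `^ (S V - beta / 4 * N ^+ 2) * b).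
Proof.
move=> hV b0 hT.
have [E|/set0Pn[H0 H0F]] := eqVneq nearOpt set0.
  by rewrite /traces E imset0 set0D cards0 !mulr_ge0 ?exprn_ge0 ?exp2_ge0.
have [p1 q1 q2] := part_sizes H0F hV.
have NL := N_large.
have nl : 100 <= beta * N by move: N_beta => h; lra.
pose B T (F : {set {set {set 'I_n}}}) := [set G in traces V | touch T G \in F].
set b' := 2 `^ _ * b.
have b'0 : 0 <= b' by rewrite mulr_ge0 ?exp2_ge0.
pose B1 := \bigcup_(y in V :\: X) B [set y] (heavyY X V mu y).
pose B2 := \bigcup_(y in V :\: X) B [set y] (sparseY X V alpha mu y).
pose B3 := \bigcup_(x in X :&: V) B [set x] (heavyX X V alpha beta mu x).
pose P4 := [set T in triples V | (T \subset X) || [disjoint T & X]].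
pose B4 := \bigcup_(T in P4) B T (monoEdge X V beta T).
have sub : traces V :\: clean X V alpha \subset (B1 :|: B2) :|: (B3 :|: B4).
  apply/subsetP => G /setDP[GV Gc]; have /imsetP[H HF E] := GV.
  have [H3 Hf Ho Hd _] := nearOptP HF.
  rewrite !in_setU.
  case: (clean_or_reducible alpha H3 Hf Ho Hd hV mu_beta (ltW mu0)); rewrite -E.
  - by move=> h; rewrite h in Gc.
  - move=> [y yV]; rewrite in_setU => /orP[] h; apply/orP; left; apply/orP; [left|right];
      by apply/bigcupP; exists y; rewrite // in_set GV.
  - move=> [x xV h]; apply/orP; right; apply/orP; left.
    by apply/bigcupP; exists x; rewrite // in_set GV.
  - move=> [T TV h]; apply/orP; right; apply/orP; right.
    by apply/bigcupP; exists T; rewrite in_set // GV.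
have one v (F : {set {set {set 'I_n}}}) : v \in V ->
    #|F|%:R <= 2 `^ (#|touch [set v] (slots X V)|%:R - beta / 4 * N ^+ 2) ->
    #|B [set v] F|%:R <= b'.
  move=> vV cF; apply: card_trace_fiber => //; first by rewrite sub1set.
  by apply: hT; rewrite ?sub1set // cards1.
have N3 : N <= N ^+ 3 by rewrite -[leLHS]expr1 ler_weXn2l //; lra.
have le_n3 (I : finType) (P : {set I}) (F : I -> {set {set {set 'I_n}}}) :
    #|P|%:R <= N ^+ 3 -> (forall i, i \in P -> #|F i|%:R <= b') ->
    #|\bigcup_(i in P) F i|%:R <= N ^+ 3 * b'.
  move=> cP h; apply: le_trans (card_bigcup_le h) _.
  by rewrite ler_wpM2r.
have cn (P : {set 'I_n}) : #|P|%:R <= N ^+ 3.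
  by apply: le_trans N3; rewrite ler_nat -[leqRHS]card_ord max_card.
have c1 : #|B1|%:R <= N ^+ 3 * b'.
  apply: le_n3 => // y yV; apply: one; first by move: yV; rewrite inE => /andP[].
  exact: card_heavyY yV.
have c2 : #|B2|%:R <= N ^+ 3 * b'.
  apply: le_n3 => // y yV; apply: one; first by move: yV; rewrite inE => /andP[].
  exact: card_sparseY yV.
have c3 : #|B3|%:R <= N ^+ 3 * b'.
  apply: le_n3 => // x xV; apply: one; first by move: xV; rewrite inE => /andP[].
  exact: card_heavyX xV.
have c4 : #|B4|%:R <= N ^+ 3 * b'.
  apply: le_n3.
    rewrite -natrX ler_nat; apply: leq_trans (card_triples_le V).
    by apply/subset_leq_card/subsetP => T; rewrite inE => /andP[].
  move=> T; rewrite in_set => /andP[TV mono].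
  have [TV' T3] : T \subset V /\ #|T| = 3%N by move: TV; rewrite inE => /andP[-> /eqP].
  apply: card_trace_fiber => //; last by apply: hT => //; rewrite T3.
  apply: card_monoEdge => //; exact/orP.
have := subset_leq_card sub; rewrite -(ler_nat R) => h; apply: le_trans h _.
have setU (C D : {set {set {set 'I_n}}}) : (#|C :|: D| <= #|C| + #|D|)%N.
  exact: leq_card_setU.
have u1 := setU (B1 :|: B2) (B3 :|: B4); have u2 := setU B1 B2; have u3 := setU B3 B4.
move: u1 u2 u3; rewrite -!(ler_nat R) !natrD => u1 u2 u3.
lra.
Qed.

(** The start of the recursion: the slots are free, and the inconsistent edges number at most eta
    n^3. *)
Lemma card_traces_crude V :
  #|traces V|%:R <= 2 `^ (S V) * 2 `^ (eps * N ^+ 3) :> R.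
Proof.
rewrite -exp2D addrC.
pose U := [set e : {set 'I_n} | #|e :&: X| != 2%N].
have cT : #|triples V|%:R <= N ^+ 3 by rewrite -natrX ler_nat card_triples_le.
apply: (@card_split_exp _ _ _ [set L : {set {set 'I_n}} | (L \subset triples V) &&
    (#|L|%:R <= eta * N ^+ 3)] (powerset (slots X V)) U).
- move=> _ /imsetP[H /nearOptP[H3 _ _ _ hi] ->]; rewrite in_set.
  rewrite (subset_trans (subsetIl _ _)) ?restr_sub //=.
  apply: le_trans hi; rewrite ler_nat; apply/subset_leq_card/subsetP => e.
  by rewrite !inE => /andP[/andP[-> _] ->].
- move=> _ /imsetP[H /nearOptP[H3 _ _ _ hi] ->]; rewrite in_set.
  apply/subsetP => e /setDP[eG]; rewrite inE negbK => e2.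
  by rewrite in_set e2 andbT (subsetP (restr_sub V H3)).
- exact: few_eta cT.
- exact: powerset_exp.
Qed.

(** The net gain of one deletion: half of the exponent beta n^2 / 4 is spent on the 4 n^3 choices of
    T. *)
Local Notation Q := (2 `^ (- (beta / 8 * N ^+ 2)) : R).

Lemma Q_bounds : 4 * N ^+ 3 * 2 `^ (- (beta / 4 * N ^+ 2)) <= Q /\
  Q * 10 <= 2 `^ (- (6 / 5 * N)).
Proof.
have NL := N_large.
have n0 : (0 < n)%N by rewrite -(@ltr0n R); lra.
have NN : 1000 * N <= beta * N ^+ 2 by rewrite expr2 mulrA ler_wpM2r.
have e4 : 4 = 2 `^ 2 :> R by exact: (exp2_nat R 2).
split.
  have -> : 4 * N ^+ 3 = 2 `^ (2 + lg R n * 3).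
    by rewrite exp2D -(exp2X _ 3) exp2_lg // -e4.
  rewrite -exp2D; apply: ler_exp2.
  by move: lg_small => l1; lra.
apply: le_trans (_ : Q * 2 `^ 4 <= _).
  rewrite ler_wpM2l ?exp2_ge0 //.
  have -> : 2 `^ 4 = 16 :> R by rewrite -(exp2_nat R 4).
  lra.
by rewrite -exp2D; apply: ler_exp2; lra.
Qed.

Lemma Q_half : Q <= 1 / 2.
Proof.
have [_ h] := Q_bounds; have : 2 `^ (- (6 / 5 * N)) <= 2 `^ 0 :> R.
  by apply: ler_exp2; move: N_large => NL; lra.
rewrite powRr0; lra.
Qed.

(** Here [j] is the number of deletions, of up to three vertices each, that the budget mu n still
    allows. If b is the factor after j of them, the next one is at most 2 + Q b, with 2 for the
    clean traces; the constant 4 reproduces itself since Q <= 1/2. *)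
Lemma card_traces_le (j : nat) V : #|~: V|%:R + 3 * j%:R <= mu * N ->
  #|traces V|%:R <= 2 `^ (S V) * (4 + Q ^+ j * 2 `^ (eps * N ^+ 3)).
Proof.
elim: j V => [|j IH] V hV.
  apply: le_trans (card_traces_crude V) _.
  by rewrite ler_wpM2l ?exp2_ge0 // expr0 mul1r lerDr.
have j0 : 0 <= j%:R :> R by exact: ler0n.
have hV' : #|~: V|%:R <= mu * N by move: hV; rewrite -natr1; lra.
set b := 4 + Q ^+ j * _ in IH.
have b0 : 0 <= b by rewrite addr_ge0 // mulr_ge0 ?exprn_ge0 ?exp2_ge0.
have [h1 _] := Q_bounds.
have hT T : T \subset V -> (#|T| <= 3)%N ->
    #|traces (V :\: T)|%:R <= 2 `^ (S (V :\: T)) * b.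
  move=> TV T3; apply: IH; apply: le_trans hV.
  have : (#|~: (V :\: T)| <= #|~: V| + 3)%N.
    rewrite setCD; apply: leq_trans (leq_card_setU _ _) _.
    by rewrite leq_add2l.
  by rewrite -(ler_nat R) natrD -natr1; lra.
have h2 := card_dirty_traces hV' b0 hT.
have [E|/set0Pn[H0 H0F]] := eqVneq nearOpt set0.
  rewrite /traces E imset0 cards0; apply: mulr_ge0; first exact: exp2_ge0.
  by rewrite addr_ge0 // mulr_ge0 ?exprn_ge0 ?exp2_ge0.
have [p1 q1 q2] := part_sizes H0F hV'.
have h3 := card_clean few_alpha p1 q2 lg_small N_large.
have h4 : 2 `^ (S V - 6 / 5 * N) <= 2 `^ (S V) :> R.
  by apply: ler_exp2; move: N_large => NL; lra.
have h5 : 4 * N ^+ 3 * (2 `^ (S V - beta / 4 * N ^+ 2) * b) <= 2 `^ (S V) * (Q * b).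
  have -> x : 4 * N ^+ 3 * (2 `^ (S V - beta / 4 * N ^+ 2) * x) =
      2 `^ (S V) * (4 * N ^+ 3 * 2 `^ (- (beta / 4 * N ^+ 2)) * x).
    by rewrite exp2D; ring.
  by rewrite ler_wpM2l ?exp2_ge0 // ler_wpM2r.
have h6 : #|traces V|%:R <= #|clean X V alpha|%:R + #|traces V :\: clean X V alpha|%:R :> R.
  rewrite -natrD ler_nat -(cardsID (clean X V alpha) (traces V)) leq_add2r.
  exact: subset_leq_card (subsetIr _ _).
have h7 : Q * b <= 2 + Q ^+ j.+1 * 2 `^ (eps * N ^+ 3).
  rewrite /b mulrDr mulrA -exprS lerD2r; move: Q_half; lra.
have h8 : 2 `^ (S V) * (Q * b) <= 2 `^ (S V) * (2 + Q ^+ j.+1 * 2 `^ (eps * N ^+ 3)).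
  by rewrite ler_wpM2l ?exp2_ge0.
apply: le_trans h6 _.
have -> : 2 `^ (S V) * (4 + Q ^+ j.+1 * 2 `^ (eps * N ^+ 3)) =
   2 `^ (S V) + 2 `^ (S V) + 2 `^ (S V) * (2 + Q ^+ j.+1 * 2 `^ (eps * N ^+ 3)) by ring.
apply: lerD; last by apply: le_trans h2 _; apply: le_trans h5 h8.
by apply: le_trans h3 _; rewrite lerD2l.
Qed.

(** One last deletion is carried out on the full vertex set, where clean and dirty graphs are kept
    apart: the clean ones with an inconsistent edge are already rare, and the dirty ones gain Q
    against a bounded factor. Each kind accounts for one of the two copies of 2^(S - 6n/5). *)
Lemma card_nearOpt_inconsistent :
  #|[set H in nearOpt | inconsistent H X != set0]|%:R <=
    2 * 2 `^ (S [set: 'I_n] - 6 / 5 * N).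
Proof.
have hV : #|~: [set: 'I_n]|%:R <= mu * N.
  by rewrite setCT cards0; move: N_mu => h; lra.
have [E|/set0Pn[H0 H0F]] := eqVneq nearOpt set0.
  rewrite (_ : [set H in _ | _] = set0) ?cards0 ?mulr_ge0 ?exp2_ge0 //.
  by apply/setP => H; rewrite in_set E !inE.
have [p1 q1 q2] := part_sizes H0F hV.
have tr : traces [set: 'I_n] = nearOpt.
  rewrite /traces -[RHS]imset_id; apply: eq_imset => H.
  by apply/setP => e; rewrite inE subsetT andbT.
have x0 : 0 <= mu * N / 3 - 2 by move: N_mu => h; lra.
(* The first deletion and [k] further ones remove at most 3 + 3k <= mu n vertices. As mu n >= 36,
   [k] still exceeds mu n / 4 - 1 and in fact reaches mu n / 4, so the total gain is beta / 8 times
   mu / 4, which is the bound beta mu / 32 on [eps]. *)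
pose k := Num.truncn (mu * N / 3 - 2).
have /andP[k1 k2] := truncn_itv x0; rewrite -/k in k1 k2.
have NL := N_large; have NM := N_mu.
have small : Q ^+ k * 2 `^ (eps * N ^+ 3) <= 1.
  rewrite exp2X -exp2D -[leRHS](powRr0 2); apply: ler_exp2.
  have k2' : mu * N / 3 - 2 < k%:R + 1 by rewrite natr1.
  have h1 : beta / 8 * N ^+ 2 * (mu * N / 4) <= beta / 8 * N ^+ 2 * k%:R.
    apply: ler_wpM2l; last lra.
    by rewrite mulr_ge0 ?divr_ge0 ?sqr_ge0 ?(ltW beta0).
  have h2 : eps * N ^+ 3 <= beta * mu / 32 * N ^+ 3 by rewrite ler_wpM2r ?exprn_ge0.
  have h3 : beta / 8 * N ^+ 2 * (mu * N / 4) = beta * mu / 32 * N ^+ 3 by field.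
  lra.
have [h1 h1'] := Q_bounds.
have hT T : T \subset [set: 'I_n] -> (#|T| <= 3)%N ->
    #|traces ([set: 'I_n] :\: T)|%:R <= 2 `^ (S ([set: 'I_n] :\: T)) * 5.
  move=> TV T3; apply: le_trans (@card_traces_le k _ _) _.
    have : (#|~: ([set: 'I_n] :\: T)| <= 3)%N by rewrite setCD setCT set0U.
    by rewrite -(ler_nat R); lra.
  by rewrite ler_wpM2l ?exp2_ge0 //; lra.
have h2 := card_dirty_traces hV (ler0n _ _) hT.
have h3 := card_clean_inconsistent few_alpha p1 q2 lg_small N_large.
have h5 : 4 * N ^+ 3 * (2 `^ (S [set: 'I_n] - beta / 4 * N ^+ 2) * 5) <=
    2 `^ (S [set: 'I_n]) * (Q * 5).
  have -> x : 4 * N ^+ 3 * (2 `^ (S [set: 'I_n] - beta / 4 * N ^+ 2) * x) =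
      2 `^ (S [set: 'I_n]) * (4 * N ^+ 3 * 2 `^ (- (beta / 4 * N ^+ 2)) * x).
    by rewrite exp2D; ring.
  by rewrite ler_wpM2l ?exp2_ge0 // ler_wpM2r.
have h6 : 2 `^ (S [set: 'I_n]) * (Q * 5) <= 2 `^ (S [set: 'I_n] - 6 / 5 * N).
  rewrite exp2D ler_wpM2l ?exp2_ge0 //; apply: le_trans h1'.
  by rewrite ler_wpM2l ?exp2_ge0 //; lra.
have h7 : (#|[set H in nearOpt | inconsistent H X != set0]| <=
    #|[set G in clean X setT alpha | inconsistent G X != set0]| +
    #|traces [set: 'I_n] :\: clean X [set: 'I_n] alpha|)%N.
  apply: leq_trans (leq_card_setU _ _); apply/subset_leq_card/subsetP => H.
  rewrite in_set => /andP[HF ne]; apply/setUP.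
  have [Hc|Hc] := boolP (H \in clean X setT alpha); [left|right].
    by rewrite in_set Hc.
  by rewrite in_setD Hc tr.
move: h7; rewrite -(ler_nat R) natrD => h7; lra.
Qed.

End Recursion.

(** * Sum over the partitions, small n and choice of the constants *)

Lemma powerset_slots_le n (X : {set 'I_n}) :
  (2 ^ #|slots X setT| <= num_semi_bipartite n)%N.
Proof.
rewrite -card_powerset; apply/subset_leq_card/subsetP => H.
rewrite inE => /subsetP HS; rewrite inE; apply/asboolP; split.
  by move=> e /HS; rewrite !inE => /andP[/andP[_ /eqP]].
exists X; apply/setP => e; rewrite !inE; apply/negP => /andP[/HS].
by rewrite !inE => /andP[_ ->].
Qed.

Lemma bad_sub (R : realType) n (alpha beta mu eta : R) : (0 < n)%N -> 0 < beta -> 0 < mu ->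
  bad n alpha beta mu eta \subset
    \bigcup_(X in [set: {set 'I_n}])
       [set H in nearOpt X mu eta | inconsistent H X != set0].
Proof.
move=> n0 b0 m0; apply/subsetP => H; rewrite inE => /asboolP[[[H3 Hf Hm] Hd] viol].
(* Conditions (1) and (2) are strict, so even an empty link satisfies them only for positive n. *)
have n2 : 0 < n%:R ^+ 2 :> R by rewrite exprn_gt0 // ltr0n.
have [X [Xo ne]] : exists X, optimal H X /\ inconsistent H X != set0.
  apply: contrapT => no; apply: viol.
  have {}no X e : optimal H X -> e \in H -> #|e :&: X| = 2%N.
    move=> Xo eH; apply/eqP/negPn/negP => e2; apply: no; exists X; split=> //.
    by apply/set0Pn; exists e; rewrite inE eH.
  have link0 X v : optimal H X -> link_graph H (~: X) (~: X) v = set0.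
    move=> Xo; apply/eqP; rewrite -subset0; apply/subsetP => r.
    case/imset2P => a b; rewrite !inE => aX /andP[bX eH] _.
    have := no _ _ Xo eH; have [vX|vX] := boolP (v \in X).
      by rewrite set3_meet1 // cards1.
    rewrite disjoint_setI0 ?cards0 // disjoints_subset.
    by rewrite -setUA !subUset !sub1set !inE vX aX bX.
  split.
  - by move=> X Xo x _; rewrite link0 // cards0 mulr_gt0.
  - by move=> X Xo y _; rewrite link0 // cards0; apply: mulr_gt0 => //; apply: mulr_gt0.
  - move=> X Xo [e [eH [x [y [z [E xX yX zX _]]]]]].
    move: yX zX; rewrite !inE => yX zX.
    by have := no _ _ Xo eH; rewrite E set3_meet1 // cards1.
  - by move=> X Xo [e]; rewrite inE => /andP[eH]; rewrite (no _ _ Xo eH).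
  - by move=> X Xo [e]; rewrite inE => /andP[eH]; rewrite (no _ _ Xo eH).
apply/bigcupP; exists X => //; rewrite in_set ne andbT inE; apply/asboolP.
split=> //; first exact: Hd.
by apply: le_trans Hm; rewrite ler_nat; exact: Xo.
Qed.

Lemma card_setT_set (T : finType) : #|[set: {set T}]| = (2 ^ #|T|)%N.
Proof. by rewrite -powersetT card_powerset cardsT. Qed.

Section Final.
Variables (R : realType) (alpha beta mu eta : R).

Hypothesis few_mu : few_small (beta / 20) (5 * mu).
Hypothesis few_alpha : few_small (1 / 100) alpha.
Hypothesis few_beta : few_small (1 / 300) (6 * beta).
Hypothesis few_eta : few_small (beta * mu / 32) eta.
Hypothesis alpha01 : 0 < alpha <= 1.
Hypothesis beta0 : 0 < beta.
Hypothesis beta_le : beta <= 1 / 25.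
Hypothesis beta_alpha : beta <= alpha ^+ 2.
Hypothesis mu0 : 0 < mu.
Hypothesis mu_le : mu <= 1 / 1000.
Hypothesis mu_beta : 5 * mu <= beta.

Lemma card_bad_large : eventually (fun n =>
  #|bad n alpha beta mu eta|%:R
    <= 2 * 2 `^ (- (n%:R / 10)) * (num_semi_bipartite n)%:R :> R).
Proof.
have c0 : 0 < 1 / 1000 :> R by lra.
have [n0 h0] := eventuallyI (eventually_ge (1000 / beta))
  (eventuallyI (eventually_ge (36 / mu)) (eventually_lg_le c0)).
exists n0.+1 => n nn0; have [h1 [h2 h3]] := h0 n (ltnW nn0).
have n1 : (0 < n)%N by apply: leq_trans nn0.
have N1 : 1000 <= beta * n%:R by rewrite mulrC -ler_pdivrMr.
have N2 : 36 <= mu * n%:R by rewrite mulrC -ler_pdivrMr.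
apply: le_trans (_ : #|\bigcup_(X in [set: {set 'I_n}])
    [set H in nearOpt X mu eta | inconsistent H X != set0]|%:R <= _).
  by rewrite ler_nat; apply/subset_leq_card/bad_sub.
set S := (num_semi_bipartite n)%:R.
apply: le_trans (card_bigcup_le (b := 2 * 2 `^ (- (6 / 5 * n%:R)) * S) _) _.
  move=> X _.
  apply: le_trans (card_nearOpt_inconsistent X few_mu few_alpha few_beta few_eta alpha01 beta0
     beta_le beta_alpha mu0 mu_le mu_beta (lexx _) N1 N2 h3) _.
  rewrite exp2D mulrA mulrAC ler_wpM2l ?mulr_ge0 ?exp2_ge0 //.
  by rewrite -exp2_nat ler_nat powerset_slots_le.
rewrite card_setT_set card_ord exp2_nat.
rewrite [leLHS]mulrA; apply: ler_wpM2r; first exact: ler0n.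
rewrite mulrCA -exp2D ler_wpM2l // ler_exp2 //.
have : 0 <= n%:R :> R by exact: ler0n.
lra.
Qed.

Lemma card_bad_le : exists C1 : R, forall n : nat,
  #|bad n alpha beta mu eta|%:R
    <= C1 * 2 `^ (- (n%:R / 10)) * (num_semi_bipartite n)%:R.
Proof.
have [n0 h] := card_bad_large.
have c0 : 0 <= (2 ^ 2 ^ n0)%:R * 2 `^ n0%:R :> R by rewrite mulr_ge0 ?exp2_ge0.
exists (2 + (2 ^ 2 ^ n0)%:R * 2 `^ n0%:R) => n.
(* Below the threshold [n0] the trivial bound 2^(2^n) suffices: the second summand of the constant
   also cancels 2^(- n / 10), and S(n) is at least 1. *)
have [/h le|nn0] := leqP n0 n.
  apply: le_trans le _; rewrite ler_wpM2r // ler_wpM2r ?exp2_ge0 //; lra.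
apply: le_trans (_ : (2 ^ 2 ^ n0)%:R <= _).
  rewrite ler_nat; apply: leq_trans (subset_leq_card (subsetT _)) _.
  rewrite card_setT_set -cardsT card_setT_set card_ord.
  by rewrite !leq_exp2l // ltnW.
have s1 : 1 <= (num_semi_bipartite n)%:R :> R.
  by rewrite ler1n; apply: leq_trans (powerset_slots_le (set0 : {set 'I_n})); rewrite expn_gt0.
have e1 : 2 `^ (- n0%:R) <= 2 `^ (- (n%:R / 10)) :> R.
  apply: ler_exp2; have : n%:R <= n0%:R :> R by rewrite ler_nat ltnW.
  have : 0 <= n%:R :> R by exact: ler0n.
  lra.
apply: le_trans (_ : (2 + (2 ^ 2 ^ n0)%:R * 2 `^ n0%:R) * 2 `^ (- n0%:R) * 1 <= _).
  rewrite mulr1 mulrDl -mulrA -exp2D subrr powRr0 mulr1 lerDr.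
  by rewrite mulr_ge0 ?exp2_ge0.
apply: ler_pM => //; first by rewrite mulr_ge0 ?exp2_ge0 // addr_ge0.
by rewrite ler_wpM2l // addr_ge0.
Qed.

End Final.

Theorem theorem16 (R : realType) :
  exists2 alpha0 : R, 0 < alpha0 & forall alpha : R, 0 < alpha < alpha0 ->
  exists2 beta0 : R, 0 < beta0 & forall beta : R, 0 < beta < beta0 ->
  exists2 mu0 : R, 0 < mu0 & forall mu : R, 0 < mu < mu0 ->
  exists2 eta0 : R, 0 < eta0 & forall eta : R, 0 < eta < eta0 ->
  entropy alpha < 1 / 100 ->
  100 * (entropy beta + entropy (2 * mu) + mu ^+ 2) < alpha ^+ 2 ->
  100 * entropy (2 * mu) < beta ->
  1000 * entropy eta <= mu ^+ 3 ->
  exists C1 : R, forall n : nat,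
    #|bad n alpha beta mu eta|%:R
      <= C1 * 2 `^ (- (n%:R / 10)) * (num_semi_bipartite n)%:R.
Proof.
have [da da0 fa] := @few_small_exists R (1 / 100) ltac:(lra).
have [db db0 fb] := @few_small_exists R (1 / 300) ltac:(lra).
exists (Num.min da 1) => [|alpha]; first by rewrite lt_min da0 ltr01.
rewrite lt_min => /andP[a0 /andP[ada a1]].
(* The divisor 6 here and the divisor 5 for mu match the thresholds [6 * beta] and [5 * mu] at which
   the families are counted. *)
exists (Num.min (db / 6) (Num.min (1 / 25) (alpha ^+ 2))) => [|beta].
  by rewrite !lt_min exprn_gt0 // !divr_gt0.
rewrite !lt_min => /andP[b0 /andP[bdb /andP[b25 ba]]].
have [dm dm0 fm] := @few_small_exists R (beta / 20) ltac:(by rewrite divr_gt0).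
exists (Num.min (dm / 5) (Num.min (1 / 1000) (beta / 5))) => [|mu].
  by rewrite !lt_min !divr_gt0.
rewrite !lt_min => /andP[m0 /andP[mdm /andP[m1000 mb]]].
have bm : 0 < beta * mu / 32 by rewrite divr_gt0 // mulr_gt0.
have [de de0 fe] := few_small_exists bm.
exists de => // eta /andP[e0 ede] _ _ _ _.
apply: card_bad_le; rewrite ?a0 //=; try exact: ltW; try lra.
- by apply: few_smallW fm; lra.
- by apply: few_smallW fa; lra.
- by apply: few_smallW fb; lra.
- by apply: few_smallW fe; lra.
Qed.
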